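(* Let $G(x,t)=\frac{1}{\sqrt{4\pi t}}e^{-|x|^2/(4t)}$ for $x\in\mathbb{R}$, $t>0$ be the one-dimensional heat kernel, and let $\hat G(x,s)=\int_0^\infty e^{-st}G(x,t)\,dt$. Then: (i) for $s>0$ and $x\in\mathbb{R}$, $\hat G(x,s)=\frac{1}{2\sqrt s}e^{-\sqrt s|x|}$; (ii) there is an absolute constant $C>0$ such that for every $0<\epsilon<0.1$ and every $T\ge 1000\delta>0$ there exist a positive integer $n\le C\log\frac{T}{\delta}\left(\log\frac1\epsilon+\log\log\frac{T}{\delta}\right)$, complex weights $w_k$ and complex nodes $s_k\in\mathbb{C}\setminus(-\infty,0]$ ($k=-n,\dots,n$) such that, with $$G_A(x,t)=\sum_{k=-n}^{n}w_k e^{s_k t}e^{-\sqrt{s_k}|x|},$$ one has $|G(x,t)-G_A(x,t)|<\frac{\epsilon}{\sqrt t}$ for all $x\in\mathbb{R}$ and all $t\in[\delta,T]$.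
   Context: $\sqrt{s}$ denotes the principal branch of the square root on $\mathbb{C}\setminus(-\infty,0]$. *)

(* Defs.v *)
From Stdlib Require Import Reals Lra.
Open Scope R_scope.

Definition heatG (x t : R) : R := / sqrt (4 * PI * t) * exp (- (x * x) / (4 * t)).

Definition improper_int_0_inf (f : R -> R) (L : R) : Prop :=
  (forall a b, 0 < a -> a <= b -> inhabited (Riemann_integrable f a b)) /\
  (forall eps, 0 < eps -> exists a0 b0, 0 < a0 /\
     forall a b (pr : Riemann_integrable f a b),
       0 < a -> a < a0 -> b0 < b -> Rabs (RiemannInt pr - L) < eps).

Record Cx := mkCx { re : R; im : R }.
Definition RtoCx (r : R) : Cx := mkCx r 0.
Definition Cxadd (a b : Cx) : Cx := mkCx (re a + re b) (im a + im b).
Definition Cxopp (a : Cx) : Cx := mkCx (- re a) (- im a).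
Definition Cxmul (a b : Cx) : Cx :=
  mkCx (re a * re b - im a * im b) (re a * im b + im a * re b).
Definition Cxmod (a : Cx) : R := sqrt (re a * re a + im a * im a).
Definition Cxexp (a : Cx) : Cx :=
  mkCx (exp (re a) * cos (im a)) (exp (re a) * sin (im a)).
(** Principal square root on C \ (-oo,0]:
    sqrt(a+ib) = sqrt((|z|+a)/2) + i sgn(b) sqrt((|z|-a)/2). *)
Definition Cxsqrt (z : Cx) : Cx :=
  mkCx (sqrt ((Cxmod z + re z) / 2))
       ((if Rlt_dec (im z) 0 then -1 else 1) * sqrt ((Cxmod z - re z) / 2)).
Definition on_cut (z : Cx) : Prop := im z = 0 /\ re z <= 0.
Fixpoint Cxsum (f : nat -> Cx) (m : nat) : Cx :=
  match m with O => RtoCx 0 | S m' => Cxadd (Cxsum f m') (f m') end.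

(** G_A(x,t) = sum_{k=-n}^{n} w_k e^{s_k t} e^{-sqrt(s_k)|x|}; the index
    k in {-n..n} is encoded as j = k + n in {0..2n}. *)
Definition GA (n : nat) (w s : nat -> Cx) (x t : R) : Cx :=
  Cxsum (fun j => Cxmul (w j)
           (Cxmul (Cxexp (Cxmul (s j) (RtoCx t)))
                  (Cxexp (Cxopp (Cxmul (Cxsqrt (s j)) (RtoCx (Rabs x)))))))
        (2 * n + 1).

(* Main.v *)
(* (i) An antiderivative of [exp (- c^2 t) G(x, t)] is explicit in terms of
   the error function, so only the Gaussian integral is needed.

   (ii) With [s = z^2] the kernel is [1/pi] times the imaginary part of the
   integral of [exp (z^2 t - z |x|)] along a path in the upper half plane. On the
   saddle line [Re z = |x| / (2 t)] this is a Gaussian integral; the line is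
   deformed into the ray [z = a + (1/2 + i) v], along which the integrand decays
   both in [z^2 t] and in [z |x|]. The ray is cut at height [v] of order at least
   [sqrt (L / delta)] and split into [O (log (T / delta))] panels of geometrically
   growing length. On each panel an [O (L)]-point rule, with nodes on the circle
   whose diameter is the panel, is exact for polynomials of degree [O (L)], hence
   exponentially accurate for [exp (A u + B u^2)]. The choice [a = sqrt (L / T)],
   [L = log (1 / eps) + log log (T / delta)], keeps [exp (a^2 t)] below [exp L]
   while avoiding extra panels for small [eps]. *)

Require Import Defs.
From Stdlib Require Import Reals Factorial Lra Lia Psatz List.
From Coquelicot Require Import Coquelicot.
Open Scope R_scope.

(** * The Gaussian integral *)

Lemma exp_le (x y : R) : x <= y -> exp x <= exp y.
Proof. intros [H|H]; [left; now apply exp_increasing|right; now rewrite H]. Qed.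

Lemma ex_RInt_continuity (f : R -> R) (a b : R) :
  (forall x, continuity_pt f x) -> ex_RInt f a b.
Proof.
  intros H. apply (ex_RInt_continuous (V := R_CompleteNormedModule)).
  intros z _. apply continuity_pt_filterlim. apply H.
Qed.

Lemma is_derive_continuity_pt (f : R -> R) (x l : R) :
  is_derive f x l -> continuity_pt f x.
Proof.
  intros H. apply continuity_pt_filterlim.
  apply (ex_derive_continuous (K := R_AbsRing) (V := R_NormedModule)).
  exists l. exact H.
Qed.

(** Differentiation under the integral sign with all hypotheses global, which removes the
    neighbourhood conditions. It serves the Gaussian integral and the contour deformation alike. *)
Lemma is_derive_RInt_param_global (k dk : R -> R -> R) (a b : R) :
  (forall l v, is_derive (fun u => k u v) l (dk l v)) ->
  (forall l v, continuity_2d_pt dk l v) ->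
  (forall l v, continuity_pt (k l) v) ->
  forall l, is_derive (fun u => RInt (k u) a b) l (RInt (dk l) a b).
Proof.
  intros Hd Hc Hk l.
  rewrite (RInt_ext (dk l) (fun t => Derive (fun u => k u t) l)).
  2:{ intros v _. symmetry. apply is_derive_unique. apply Hd. }
  apply (is_derive_RInt_param k a b l).
  - apply filter_forall. intros u t _. exists (dk u t). apply Hd.
  - intros t _. apply continuity_2d_pt_ext with (2 := Hc l t).
    intros u v. symmetry. apply is_derive_unique. apply Hd.
  - apply filter_forall. intros u. apply ex_RInt_continuity. apply Hk.
Qed.

Ltac cont2d :=
  repeat first
    [ apply continuity_2d_pt_id1 | apply continuity_2d_pt_id2
    | apply continuity_2d_pt_const
    | apply continuity_2d_pt_plus | apply continuity_2d_pt_minus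
    | apply continuity_2d_pt_mult | apply continuity_2d_pt_opp
    | apply (continuity_1d_2d_pt_comp exp);
        [apply derivable_continuous_pt, derivable_pt_exp|]
    | apply (continuity_1d_2d_pt_comp sin);
        [apply derivable_continuous_pt, derivable_pt_sin|]
    | apply (continuity_1d_2d_pt_comp cos);
        [apply derivable_continuous_pt, derivable_pt_cos|] ].

(** This is [sqrt PI / 2] times the error function. *)
Definition gint (y : R) : R := RInt (fun u => exp (- (u * u))) 0 y.

Lemma gauss_continuity (x : R) : continuity_pt (fun u => exp (- (u * u))) x.
Proof.
  apply is_derive_continuity_pt with (- (2 * x) * exp (- (x * x))).
  auto_derive; [easy|ring].
Qed.

Lemma is_derive_gint (y : R) : is_derive gint y (exp (- (y * y))).
Proof.
  apply (is_derive_RInt (fun u => exp (- (u * u))) gint 0 y).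
  - apply filter_forall. intros u. apply (RInt_correct (V := R_CompleteNormedModule)).
    apply ex_RInt_continuity. apply gauss_continuity.
  - apply continuity_pt_filterlim. apply gauss_continuity.
Qed.

Lemma gint_0 : gint 0 = 0.
Proof. apply (RInt_point (V := R_CompleteNormedModule)). Qed.

Lemma gint_ge0 (y : R) : 0 <= y -> 0 <= gint y.
Proof.
  intros Hy. apply RInt_ge_0; [easy| |].
  - apply ex_RInt_continuity, gauss_continuity.
  - intros u _. left. apply exp_pos.
Qed.

(** The sum of both sides' [gint] values has zero derivative and vanishes at 0. Oddness is needed
    because one Gaussian argument in [heat_primitive] tends to minus infinity as [t] tends to 0. *)
Lemma gint_opp (y : R) : gint (- y) = - gint y.
Proof.
  pose (f := fun y => gint (- y) + gint y).
  assert (Hd : forall x, is_derive f x 0).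
  { intros x. unfold f.
    replace 0 with (plus (scal (-1) (exp (- (- x * - x)))) (exp (- (x * x)))).
    2:{ unfold plus, scal; simpl; unfold mult; simpl.
        replace (- x * - x) with (x * x) by ring. ring. }
    apply (is_derive_plus (K := R_AbsRing) (V := R_NormedModule)).
    - apply (is_derive_comp (K := R_AbsRing) (V := R_NormedModule) gint Ropp).
      + apply is_derive_gint.
      + auto_derive; [easy|ring].
    - apply is_derive_gint. }
  destruct (MVT_gen f 0 y (fun _ => 0)) as [c [_ Hc]].
  - intros; apply Hd.
  - intros. eapply is_derive_continuity_pt, Hd.
  - unfold f in Hc. rewrite Ropp_0, gint_0 in Hc. lra.
Qed.

(* [gint y ^ 2 + gauss_aux y] has zero derivative, hence equals [PI / 4]. *)
Definition gauss_aux (y : R) : R :=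
  RInt (fun s => exp (- (y * y) * (1 + s * s)) * / (1 + s * s)) 0 1.

(** Differentiating in [y] cancels the denominator [1 + s^2]; the substitution [u = y s] then turns
    the remaining integral into [gint y]. *)
Lemma is_derive_gauss_aux (y : R) :
  is_derive gauss_aux y (- (2 * exp (- (y * y)) * gint y)).
Proof.
  assert (Hn : forall s, 1 + s * s <> 0) by (intros s; nra).
  replace (- (2 * exp (- (y * y)) * gint y)) with
    (RInt (fun s => - (2 * y) * exp (- (y * y) * (1 + s * s))) 0 1).
  - apply (is_derive_RInt_param_global
      (fun u s => exp (- (u * u) * (1 + s * s)) * / (1 + s * s))
      (fun u s => - (2 * u) * exp (- (u * u) * (1 + s * s)))).
    + intros l v. auto_derive; [easy|]. field. apply Hn.
    + intros l v. cont2d.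
    + intros l v. eapply is_derive_continuity_pt. auto_derive; [apply Hn|reflexivity].
  - apply is_RInt_unique.
    (* The terms [+ 0] give the argument the affine shape required by the linear substitution
       [is_RInt_comp_lin]. *)
    apply (is_RInt_ext (fun s => scal (- (2 * exp (- (y * y))))
             (scal y (exp (- ((y * s + 0) * (y * s + 0))))))).
    { intros s _. unfold scal; simpl; unfold mult; simpl.
      replace (- (y * y) * (1 + s * s)) with
        (- (y * y) + - ((y * s + 0) * (y * s + 0))) by ring.
      rewrite exp_plus. ring. }
    replace (- (2 * exp (- (y * y)) * gint y)) with
      (scal (- (2 * exp (- (y * y)))) (gint y))
      by (unfold scal; simpl; unfold mult; simpl; ring).
    apply (is_RInt_scal (V := R_NormedModule)).
    apply (is_RInt_comp_lin (V := R_NormedModule) (fun u => exp (- (u * u)))).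
    replace (y * 0 + 0) with 0 by ring. replace (y * 1 + 0) with y by ring.
    apply (RInt_correct (V := R_CompleteNormedModule)).
    apply ex_RInt_continuity, gauss_continuity.
Qed.

Lemma gauss_aux_0 : gauss_aux 0 = PI / 4.
Proof.
  unfold gauss_aux. apply is_RInt_unique.
  rewrite <- atan_1. replace (atan 1) with (minus (atan 1) (atan 0)).
  2:{ rewrite atan_0. unfold minus, plus, opp; simpl. ring. }
  apply (is_RInt_derive (V := R_CompleteNormedModule) atan).
  - intros x _. apply is_derive_Reals.
    replace (exp _ * _) with (/ (1 + x ^ 2)).
    + apply derivable_pt_lim_atan.
    + replace (- (0 * 0) * (1 + x * x)) with 0 by ring. rewrite exp_0.
      field. nra.
  - intros x _. apply continuity_pt_filterlim.
    eapply is_derive_continuity_pt. auto_derive; [nra|reflexivity].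
Qed.

Lemma gint_sq (y : R) : gint y * gint y = PI / 4 - gauss_aux y.
Proof.
  pose (f := fun y => gint y * gint y + gauss_aux y).
  assert (Hd : forall x, is_derive f x 0).
  { intros x. unfold f.
    replace 0 with (plus (plus (mult (exp (- (x * x))) (gint x))
                               (mult (gint x) (exp (- (x * x)))))
                         (- (2 * exp (- (x * x)) * gint x))).
    2:{ unfold plus, mult; simpl. unfold mult; simpl. ring. }
    apply (is_derive_plus (K := R_AbsRing) (V := R_NormedModule)).
    - apply (is_derive_mult gint gint); try apply is_derive_gint.
      intros; apply Rmult_comm.
    - apply is_derive_gauss_aux. }
  destruct (MVT_gen f 0 y (fun _ => 0)) as [c [_ Hc]].
  - intros; apply Hd.
  - intros. eapply is_derive_continuity_pt, Hd.
  - unfold f in Hc. rewrite gint_0, gauss_aux_0 in Hc. lra.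
Qed.

Lemma gauss_aux_bound (y : R) : 0 <= gauss_aux y <= exp (- (y * y)).
Proof.
  assert (Hn : forall s, 0 < 1 + s * s) by (intros s; nra).
  assert (He : ex_RInt (fun s => exp (- (y * y) * (1 + s * s)) * / (1 + s * s)) 0 1).
  { apply ex_RInt_continuity. intros s. eapply is_derive_continuity_pt.
    auto_derive; [specialize (Hn s); lra|reflexivity]. }
  split.
  - apply RInt_ge_0; [lra|exact He|]. intros s _. apply Rlt_le, Rmult_lt_0_compat.
    apply exp_pos. apply Rinv_0_lt_compat, Hn.
  - replace (exp (- (y * y))) with (RInt (fun _ => exp (- (y * y))) 0 1).
    2:{ rewrite (RInt_const (V := R_CompleteNormedModule)).
        unfold scal; simpl; unfold mult; simpl. ring. }
    apply RInt_le; [lra|exact He|apply ex_RInt_const|].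
    intros s Hs. rewrite <- (Rmult_1_r (exp (- (y * y)))).
    apply Rmult_le_compat.
    + left; apply exp_pos.
    + left; apply Rinv_0_lt_compat, Hn.
    + apply exp_le. nra.
    + rewrite <- Rinv_1. apply Rinv_le_contravar; nra.
Qed.

(** By [gint_sq], the product of [sqrt PI / 2 - gint y] and [sqrt PI / 2 + gint y] is [gauss_aux y];
    the second factor is at least 1/2, whence the constant 2. *)
Lemma gint_tail (y : R) : 0 <= y ->
  0 <= sqrt PI / 2 - gint y <= 2 * exp (- (y * y)).
Proof.
  intros Hy. pose proof (gint_sq y) as H1. pose proof (gauss_aux_bound y) as H2.
  pose proof (gint_ge0 y Hy) as H3. pose proof PI2_1 as H4.
  assert (H5 : sqrt PI * sqrt PI = PI) by (apply sqrt_sqrt; lra).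
  assert (H6 : 1 <= sqrt PI).
  { rewrite <- sqrt_1. apply sqrt_le_1; lra. }
  set (r := sqrt PI) in *. split; nra.
Qed.

(** * The Laplace transform of the heat kernel *)

(* The two Gaussians arise by completing the square:
   [(c sqrt t -+ x / (2 sqrt t))^2 = c^2 t -+ c x + x^2 / (4 t)]. *)
Definition heat_primitive (c x t : R) : R :=
  (exp (- c * x) * gint (c * sqrt t - x / (2 * sqrt t))
   + exp (c * x) * gint (c * sqrt t + x / (2 * sqrt t))) / (2 * c * sqrt PI).

Lemma is_derive_heat_primitive (c x t : R) : 0 < c -> 0 < t ->
  is_derive (heat_primitive c x) t (exp (- (c * c) * t) * heatG x t).
Proof.
  intros Hc Ht. pose proof (sqrt_lt_R0 t Ht) as Hs.
  pose proof PI_RGT_0 as HP. pose proof (sqrt_lt_R0 _ HP) as HsP.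
  assert (Hst : sqrt t * sqrt t = t) by (apply sqrt_sqrt; lra).
  assert (Hd : forall y, ex_derive gint y) by (intros y; eexists; apply is_derive_gint).
  unfold heat_primitive, heatG.
  auto_derive; [repeat split; trivial; lra|].
  rewrite !(is_derive_unique gint _ _ (is_derive_gint _)).
  replace (4 * PI * t) with ((2 * 2) * (PI * t)) by ring.
  rewrite sqrt_mult, sqrt_square, sqrt_mult by nra.
  assert (H1 : exp (- (c * c) * t) * exp (- (x * x) / (4 * t)) =
    exp (- c * x) * exp (- ((c * sqrt t + - (x * / (2 * sqrt t)))
                            * (c * sqrt t + - (x * / (2 * sqrt t)))))).
  { rewrite <- !exp_plus. f_equal. clear -Hs Hst. set (r := sqrt t) in *.
    clearbody r. subst t. field. lra. }
  assert (H2 : exp (- (c * c) * t) * exp (- (x * x) / (4 * t)) =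
    exp (c * x) * exp (- ((c * sqrt t + x * / (2 * sqrt t))
                            * (c * sqrt t + x * / (2 * sqrt t))))).
  { rewrite <- !exp_plus. f_equal. clear -Hs Hst. set (r := sqrt t) in *.
    clearbody r. subst t. field. lra. }
  set (E1 := exp (- ((c * sqrt t + - _) * _))) in *.
  set (E2 := exp (- ((c * sqrt t + x * _) * _))) in *.
  set (E := exp (- (c * c) * t)) in *. set (E' := exp (- (x * x) / (4 * t))) in *.
  set (F1 := exp (- c * x)) in *. set (F2 := exp (c * x)) in *.
  replace (E * (/ (2 * (sqrt PI * sqrt t)) * E'))
    with ((E * E') / (2 * sqrt PI * sqrt t)) by (field; lra).
  (* The chain rule gives each Gaussian the factor [c / (2 sqrt t)] plus or minus [x / (4 t^(3/2))].
     Both [F1 * E1] and [F2 * E2] equal [E * E'], so the [x] terms cancel. *)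
  transitivity ((F1 * E1 * (c / (2 * sqrt t) + x / (4 * (sqrt t * sqrt t * sqrt t)))
     + F2 * E2 * (c / (2 * sqrt t) - x / (4 * (sqrt t * sqrt t * sqrt t))))
      / (2 * c * sqrt PI)).
  - field. lra.
  - rewrite <- H1, <- H2. field. lra.
Qed.

Lemma heat_integrand_continuity (c x t : R) : 0 < t ->
  continuity_pt (fun t => exp (- (c * c) * t) * heatG x t) t.
Proof.
  intros Ht. pose proof PI_RGT_0.
  assert (0 < 4 * PI * t) by nra. pose proof (sqrt_lt_R0 _ H0).
  eapply is_derive_continuity_pt. unfold heatG.
  auto_derive; [repeat split; lra|reflexivity].
Qed.

Lemma is_RInt_heat (c x a b : R) : 0 < c -> 0 < a -> 0 < b ->
  is_RInt (fun t => exp (- (c * c) * t) * heatG x t) a b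
    (heat_primitive c x b - heat_primitive c x a).
Proof.
  intros Hc Ha Hb.
  apply (is_RInt_derive (V := R_CompleteNormedModule) (heat_primitive c x)).
  - intros t Ht. apply is_derive_heat_primitive; [easy|].
    apply Rlt_le_trans with (2 := proj1 Ht). now apply Rmin_pos.
  - intros t Ht. apply continuity_pt_filterlim, heat_integrand_continuity.
    apply Rlt_le_trans with (2 := proj1 Ht). now apply Rmin_pos.
Qed.

Lemma gint_near_limit (eps : R) : 0 < eps ->
  exists M, 0 < M /\ forall y, M <= y -> Rabs (gint y - sqrt PI / 2) < eps.
Proof.
  intros He. exists (Rmax 1 (2 / eps)). pose proof (Rmax_l 1 (2 / eps)).
  pose proof (Rmax_r 1 (2 / eps)). split; [lra|]. intros y Hy.
  assert (H2 : 2 / eps <= y) by lra. assert (H1 : 1 <= y) by lra.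
  pose proof (gint_tail y ltac:(lra)) as Ht.
  assert (Hexp : exp (- (y * y)) < / y).
  { rewrite exp_Ropp. apply Rinv_lt_contravar.
    - apply Rmult_lt_0_compat; [lra|apply exp_pos].
    - pose proof (exp_ineq1 (y * y)). nra. }
  assert (2 * / y <= eps).
  { apply Rmult_le_reg_r with y; [lra|]. rewrite Rmult_assoc, Rinv_l by lra.
    apply Rmult_le_reg_r with (/ eps); [now apply Rinv_0_lt_compat|].
    replace (eps * y * / eps) with y by (field; lra). unfold Rdiv in H2. lra. }
  rewrite Rabs_left1; lra.
Qed.

(** One tolerance [eta] serves both [gint] values in [heat_primitive], so that the limits of the
    primitive reduce to limits of [gint]. *)
Lemma weighted_near (e1 e2 K eps : R) : 0 < e1 -> 0 < e2 -> 0 < K -> 0 < eps ->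
  exists eta, 0 < eta /\ forall g1 g2 l1 l2,
    Rabs (g1 - l1) < eta -> Rabs (g2 - l2) < eta ->
    Rabs ((e1 * g1 + e2 * g2) / K - (e1 * l1 + e2 * l2) / K) < eps.
Proof.
  intros H1 H2 HK He. exists (eps * K / (e1 + e2)).
  assert (Hpos : 0 < eps * K / (e1 + e2))
    by (apply Rdiv_lt_0_compat; [now apply Rmult_lt_0_compat|lra]).
  split; [easy|]. intros g1 g2 l1 l2 Hg1 Hg2.
  replace ((e1 * g1 + e2 * g2) / K - (e1 * l1 + e2 * l2) / K)
    with ((e1 * (g1 - l1) + e2 * (g2 - l2)) / K) by (field; lra).
  unfold Rdiv. rewrite Rabs_mult, Rabs_inv, (Rabs_pos_eq K) by lra.
  apply Rmult_lt_reg_r with K; [easy|]. rewrite Rmult_assoc, Rinv_l, Rmult_1_r by lra.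
  set (eta := eps * K / (e1 + e2)) in *.
  replace (eps * K) with (e1 * eta + e2 * eta) by (unfold eta; field; lra).
  apply Rle_lt_trans with (1 := Rabs_triang _ _).
  rewrite !Rabs_mult, (Rabs_pos_eq e1), (Rabs_pos_eq e2) by lra.
  apply Rplus_lt_compat; now apply Rmult_lt_compat_l.
Qed.

Lemma heat_primitive_infinity (c x eps : R) : 0 < c -> 0 <= x -> 0 < eps ->
  exists b0, 0 < b0 /\ forall b, b0 < b ->
    Rabs (heat_primitive c x b - (exp (- c * x) + exp (c * x)) / (4 * c)) < eps.
Proof.
  intros Hc Hx He. pose proof (sqrt_lt_R0 _ PI_RGT_0) as HP.
  destruct (weighted_near (exp (- c * x)) (exp (c * x)) (2 * c * sqrt PI) eps)
    as [eta [Heta Hw]]; try apply exp_pos; trivial; [nra|].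
  destruct (gint_near_limit eta Heta) as [M [HM Hg]].
  (* [c * r0] exceeds [M + x], and [r0 >= 1] keeps [x / (2 sqrt b)] below [x]; hence both Gaussian
     arguments are at least [M]. *)
  set (r0 := 1 + (M + x) / c).
  assert (Hr0 : 1 <= r0).
  { unfold r0. assert (0 < (M + x) / c) by (apply Rdiv_lt_0_compat; lra). lra. }
  exists (r0 * r0). split; [nra|]. intros b Hb.
  assert (Hr : r0 <= sqrt b).
  { rewrite <- (sqrt_square r0) by lra. apply sqrt_le_1_alt. lra. }
  replace ((exp (- c * x) + exp (c * x)) / (4 * c)) with
    ((exp (- c * x) * (sqrt PI / 2) + exp (c * x) * (sqrt PI / 2)) / (2 * c * sqrt PI))
    by (field; lra).
  assert (H1 : M + x <= c * sqrt b).
  { apply Rle_trans with (c * r0); [|nra].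
    unfold r0. replace (c * (1 + (M + x) / c)) with (c + (M + x)) by (field; lra). lra. }
  assert (H2 : 0 <= x / (2 * sqrt b) <= x).
  { split; [apply Rdiv_le_0_compat; lra|].
    apply Rmult_le_reg_r with (2 * sqrt b); [lra|].
    replace (x / (2 * sqrt b) * (2 * sqrt b)) with x by (field; lra). nra. }
  apply Hw; apply Hg; lra.
Qed.

(** For [x > 0] the two Gaussian arguments tend to minus and plus infinity, hence the difference of
    exponentials; for [x = 0] both tend to 0 and so does the primitive. *)
Lemma heat_primitive_zero (c x eps : R) : 0 < c -> 0 <= x -> 0 < eps ->
  exists a0, 0 < a0 /\ forall a, 0 < a -> a < a0 ->
    Rabs (heat_primitive c x a - (exp (c * x) - exp (- c * x)) / (4 * c)) < eps.
Proof.
  intros Hc Hx He. pose proof (sqrt_lt_R0 _ PI_RGT_0) as HP.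
  destruct (weighted_near (exp (- c * x)) (exp (c * x)) (2 * c * sqrt PI) eps)
    as [eta [Heta Hw]]; try apply exp_pos; trivial; [nra|].
  destruct Hx as [Hx|Hx].
  - destruct (gint_near_limit eta Heta) as [M [HM Hg]].
    (* The bound 1 keeps [c sqrt a] below [c]; the other bound makes [x / (2 sqrt a)] at least
       [M + c]. *)
    set (r0 := Rmin 1 (x / (2 * (M + c)))).
    assert (Hr0 : 0 < r0 <= 1).
    { split; [|apply Rmin_l]. apply Rmin_pos; [lra|]. apply Rdiv_lt_0_compat; lra. }
    assert (Hr0' : r0 * (2 * (M + c)) <= x).
    { apply Rle_trans with (x / (2 * (M + c)) * (2 * (M + c))).
      - apply Rmult_le_compat_r; [lra|apply Rmin_r].
      - right; field; lra. }
    exists (r0 * r0). split; [nra|]. intros a Ha Hb.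
    pose proof (sqrt_lt_R0 _ Ha) as Hsa.
    assert (Hr : sqrt a <= r0).
    { rewrite <- (sqrt_square r0) by lra. apply sqrt_le_1_alt. lra. }
    replace ((exp (c * x) - exp (- c * x)) / (4 * c)) with
      ((exp (- c * x) * - (sqrt PI / 2) + exp (c * x) * (sqrt PI / 2)) / (2 * c * sqrt PI))
      by (field; lra).
    assert (H1 : M + c <= x / (2 * sqrt a)).
    { apply Rmult_le_reg_r with (2 * sqrt a); [lra|].
      replace (x / (2 * sqrt a) * (2 * sqrt a)) with x by (field; lra). nra. }
    apply Hw.
    + rewrite <- (Ropp_involutive (c * sqrt a - _)), gint_opp.
      rewrite <- Rabs_Ropp. replace (- (- _ - - _)) with
        (gint (- (c * sqrt a - x / (2 * sqrt a))) - sqrt PI / 2) by ring.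
      apply Hg. nra.
    + apply Hg. nra.
  - subst x.
    pose proof (is_derive_continuity_pt gint 0 _ (is_derive_gint 0)) as Hcont.
    destruct (Hcont eta Heta) as [al [Hal Hcl]].
    set (r0 := al / c). assert (Hr0 : 0 < r0) by (apply Rdiv_lt_0_compat; lra).
    exists (r0 * r0). split; [nra|]. intros a Ha Hb.
    pose proof (sqrt_lt_R0 _ Ha) as Hsa.
    assert (Hr : sqrt a < r0).
    { rewrite <- (sqrt_square r0) by lra. apply sqrt_lt_1_alt. lra. }
    assert (Hlt : c * sqrt a < al).
    { replace al with (c * r0) by (unfold r0; field; lra). nra. }
    replace ((exp (c * 0) - exp (- c * 0)) / (4 * c)) with
      ((exp (- c * 0) * 0 + exp (c * 0) * 0) / (2 * c * sqrt PI)).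
    2:{ rewrite !Rmult_0_r. field. lra. }
    assert (Hg : Rabs (gint (c * sqrt a) - 0) < eta).
    { rewrite <- gint_0. apply Hcl. split.
      - split; [exact I|]. nra.
      - simpl. unfold Rdist. rewrite Rminus_0_r, Rabs_pos_eq; nra. }
    apply Hw; [replace (c * sqrt a - 0 / (2 * sqrt a)) with (c * sqrt a) by (field; lra)
              |replace (c * sqrt a + 0 / (2 * sqrt a)) with (c * sqrt a) by (field; lra)];
      exact Hg.
Qed.

(** The growing exponentials [exp (c |x|)] cancel between the limits of the primitive at infinity
    and at zero, which leaves [exp (- c |x|) / (2 c)]. *)
Lemma laplace_heat (s x : R) : 0 < s ->
  improper_int_0_inf (fun t => exp (- s * t) * heatG x t)
    (/ (2 * sqrt s) * exp (- sqrt s * Rabs x)).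
Proof.
  intros Hs. set (c := sqrt s). assert (Hc : 0 < c) by now apply sqrt_lt_R0.
  assert (Hx : 0 <= Rabs x) by apply Rabs_pos.
  assert (Hi : forall a b, 0 < a -> 0 < b ->
    is_RInt (fun t => exp (- s * t) * heatG x t) a b
      (heat_primitive c (Rabs x) b - heat_primitive c (Rabs x) a)).
  { intros a b Ha Hb. apply (is_RInt_ext (fun t => exp (- (c * c) * t) * heatG (Rabs x) t)).
    - intros t _. unfold c. rewrite sqrt_sqrt by lra. unfold heatG.
      now rewrite <- Rabs_mult, (Rabs_pos_eq (x * x)) by nra.
    - now apply is_RInt_heat. }
  split.
  - intros a b Ha Hab. constructor. apply ex_RInt_Reals_0. eexists. apply Hi; lra.
  - intros eps He.
    destruct (heat_primitive_infinity c (Rabs x) (eps / 2)) as [b0 [Hb0 Hb]]; try lra.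
    destruct (heat_primitive_zero c (Rabs x) (eps / 2)) as [a0 [Ha0 Ha]]; try lra.
    exists a0, b0. split; [easy|]. intros a b pr H1 H2 H3.
    rewrite <- RInt_Reals. rewrite (is_RInt_unique _ _ _ _ (Hi a b H1 ltac:(lra))).
    specialize (Hb b H3). specialize (Ha a H1 H2).
    set (u := heat_primitive _ _ b) in *. set (v := heat_primitive _ _ a) in *.
    replace (/ (2 * c) * exp (- c * Rabs x)) with
      ((exp (- c * Rabs x) + exp (c * Rabs x)) / (4 * c)
       - (exp (c * Rabs x) - exp (- c * Rabs x)) / (4 * c)) by (field; lra).
    apply Rabs_def2 in Ha. apply Rabs_def2 in Hb. apply Rabs_def1; lra.
Qed.

(** * Contour deformation *)

(** Identifies the occurrences of [f] whose arguments agree up to [field], so that a final [field]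
    sees a single atom. *)
Ltac fold_fun f :=
  match goal with |- context [f ?e] =>
    let E := fresh "E" in set (E := f e);
    repeat match goal with |- context [f ?e'] =>
      replace (f e') with E by (unfold E; f_equal; field) end
  end.

(* [Im ((p + i) exp (z^2 - z X))] at [z = b + p v + i v]. *)
Definition line_integrand (X b p v : R) : R :=
  exp ((b + p * v) * (b + p * v) - v * v - (b + p * v) * X)
  * (p * sin (v * (2 * (b + p * v) - X)) + cos (v * (2 * (b + p * v) - X))).

Lemma line_integrand_continuity (X b p v : R) : continuity_pt (line_integrand X b p) v.
Proof.
  eapply is_derive_continuity_pt. unfold line_integrand. auto_derive; [easy|reflexivity].
Qed.

(* Deforming the line [X/2 + i v] linearly into [a + v/2 + i v]: by the
   Cauchy-Riemann equations the [l]-derivative of the integrand is a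
   [v]-derivative, so only the end point [v = Y] contributes. *)
Lemma is_derive_contour (X a Y l : R) :
  is_derive (fun l => RInt (line_integrand X ((1 - l) * (X / 2) + l * a) (l / 2)) 0 Y) l
    (let g := a + Y / 2 - X / 2 in
     let xi := (1 - l) * (X / 2) + l * a + l / 2 * Y in
     g * exp (xi * xi - Y * Y - xi * X) * sin (Y * (2 * xi - X))).
Proof.
  pose (dk := fun l v : R =>
     let g := a + v / 2 - X / 2 in
     let xi := (1 - l) * (X / 2) + l * a + l / 2 * v in
     let e := exp (xi * xi - v * v - xi * X) in
     let ph := v * (2 * xi - X) in
     (/ 2) * e * sin ph + g * (l / 2 * (2 * xi - X) - 2 * v) * e * sin ph
     + g * e * cos ph * (2 * xi - X + v * l)).
  match goal with |- is_derive _ _ ?d =>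
    replace d with (RInt (dk l) 0 Y) end.
  - apply (is_derive_RInt_param_global
      (fun l v => line_integrand X ((1 - l) * (X / 2) + l * a) (l / 2) v) dk).
    + intros u v. unfold line_integrand, dk. auto_derive; [easy|].
      cbv zeta. unfold Rdiv, Rminus.
      fold_fun exp. fold_fun sin. fold_fun cos.
      field.
    + intros u v. unfold dk. cbv zeta. unfold Rdiv. cont2d.
    + intros u v. apply line_integrand_continuity.
  - apply is_RInt_unique.
    (* With [z = xi + i v] and [f(z) = exp (z^2 - z X)], the integrand is the imaginary part of
       [z_v f(z)] and [F] that of [z_l f(z)], where [z_l = g]. Since [f] is holomorphic, the
       [l]-derivative of the former equals the [v]-derivative of the latter. At [v = 0] the path is
       real, so [F 0 = 0]. *)
    pose (F := fun v : R =>
      let g := a + v / 2 - X / 2 in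
      let xi := (1 - l) * (X / 2) + l * a + l / 2 * v in
      g * exp (xi * xi - v * v - xi * X) * sin (v * (2 * xi - X))).
    change (is_RInt (dk l) 0 Y (F Y)).
    replace (F Y) with (minus (F Y) (F 0)).
    2:{ unfold F, minus, plus, opp; simpl. rewrite (Rmult_0_l (2 * _ - X)), sin_0. ring. }
    apply (is_RInt_derive (V := R_CompleteNormedModule) F).
    + intros v _. unfold F, dk. auto_derive; [easy|].
      cbv zeta. unfold Rdiv, Rminus.
      fold_fun exp. fold_fun sin. fold_fun cos.
      field.
    + intros v _. apply continuity_pt_filterlim. unfold dk. cbv zeta.
      eapply is_derive_continuity_pt. auto_derive; [easy|reflexivity].
Qed.

(** Absorbs the factor, linear in [X], that comes from the speed of the deformation; this makes the
    truncation bound uniform in [X]. *)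
Lemma add_mul_exp_le (b X : R) : 1 <= b -> 0 <= X ->
  (b + X / 2) * exp (- (b * X)) <= b + 1 / 2.
Proof.
  intros Hb HX. pose proof (exp_pos (- (b * X))).
  assert (exp (- (b * X)) <= 1) by (rewrite <- exp_0; apply exp_le; nra).
  assert (X * exp (- (b * X)) <= 1).
  { rewrite exp_Ropp. pose proof (exp_ineq1_le (b * X)).
    apply Rmult_le_reg_r with (exp (b * X)); [apply exp_pos|].
    rewrite Rmult_assoc, Rinv_l by (apply Rgt_not_eq, exp_pos). nra. }
  nra.
Qed.

(** The mean value theorem in [l] compares the ray with the saddle line, where the integral is
    [exp (- (X * X / 4)) * gint Y]. The end point contribution and the tail of [gint] account for
    half of the bound each. *)
Lemma contour_truncation (X a Y : R) : 0 <= X -> 0 < a -> 2 <= Y -> 10 * a <= Y ->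
  Rabs (sqrt PI / 2 * exp (- (X * X / 4)) - RInt (line_integrand X a (/ 2)) 0 Y)
  <= 4 * exp (- (Y * Y / 10)).
Proof.
  intros HX Ha HY HaY.
  set (K := fun l => RInt (line_integrand X ((1 - l) * (X / 2) + l * a) (l / 2)) 0 Y).
  assert (HK1 : RInt (line_integrand X a (/ 2)) 0 Y = K 1).
  { unfold K. f_equal. f_equal; field. }
  assert (HK0 : K 0 = exp (- (X * X / 4)) * gint Y).
  { unfold K, gint.
    rewrite <- (RInt_scal (V := R_CompleteNormedModule) (fun u => exp (- (u * u))))
      by (apply ex_RInt_continuity, gauss_continuity).
    apply RInt_ext. intros v _. unfold scal; simpl; unfold mult; simpl.
    unfold line_integrand. rewrite <- exp_plus.
    replace (v * (2 * _ - X)) with 0 by field. rewrite sin_0, cos_0, Rmult_0_r, Rplus_0_l, Rmult_1_r.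
    f_equal. field. }
  destruct (MVT_gen K 0 1 _ (fun l _ => is_derive_contour X a Y l)) as [l [Hl HMVT]].
  { intros l _. eapply is_derive_continuity_pt, is_derive_contour. }
  rewrite Rmin_left, Rmax_right in Hl by lra. cbv zeta in HMVT.
  rewrite HK1. pose proof (gint_tail Y ltac:(lra)) as Ht.
  set (D := _ * sin _) in HMVT.
  set (g := a + Y / 2 - X / 2) in *.
  set (xi := (1 - l) * (X / 2) + l * a + l / 2 * Y) in *.
  assert (Hexp10 : exp (- (Y * Y)) <= exp (- (Y * Y / 10))) by (apply exp_le; nra).
  assert (Hsmall : exp (- (X * X / 4)) <= 1) by (rewrite <- exp_0; apply exp_le; nra).
  assert (HD : Rabs D <= 2 * exp (- (Y * Y / 10))).
  { unfold D. rewrite !Rabs_mult, (Rabs_pos_eq (exp _)) by (left; apply exp_pos).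
    set (beta := a + Y / 2).
    (* Since [xi - X / 2 = l * g], the worst case is [l = 1], where [xi] is [beta], the real part of
       the end point of the ray. As [a <= Y / 10], [beta <= 6 / 10 * Y], and [beta^2] costs less
       than [4 / 10 * Y^2]. *)
    assert (Hxi : xi * xi - Y * Y - xi * X <= - (6 / 10 * (Y * Y)) + - (beta * X)).
    { assert (Hx2 : xi - X / 2 = l * g) by (unfold xi, g; field).
      assert (Hl2 : l * g * (l * g) <= g * g).
      { assert (0 <= l * l <= 1) by nra. pose proof (Rle_0_sqr g). unfold Rsqr in *. nra. }
      assert (xi * xi - xi * X = l * g * (l * g) - X * X / 4)
        by (rewrite <- Hx2; field).
      assert (g * g - X * X / 4 = beta * beta - beta * X) by (unfold g, beta; field).
      assert (beta * beta <= 4 / 10 * (Y * Y)) by (unfold beta; nra). lra. }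
    pose proof (SIN_bound (Y * (2 * xi - X))) as Hsin.
    assert (Hs1 : Rabs (sin (Y * (2 * xi - X))) <= 1) by (apply Rabs_le; lra).
    assert (Hg : Rabs g <= beta + X / 2) by (unfold g, beta; apply Rabs_le; lra).
    assert (He : exp (xi * xi - Y * Y - xi * X)
                 <= exp (- (6 / 10 * (Y * Y))) * exp (- (beta * X)))
      by (rewrite <- exp_plus; now apply exp_le).
    pose proof (add_mul_exp_le beta X ltac:(unfold beta; lra) HX) as Hb.
    assert (HbY : beta + 1 / 2 <= Y) by (unfold beta; lra).
    apply Rle_trans with ((beta + X / 2) * (exp (- (6 / 10 * (Y * Y))) * exp (- (beta * X)))).
    { rewrite <- (Rmult_1_r ((beta + X / 2) * _)).
      apply Rmult_le_compat; try apply Rabs_pos; try easy.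
      - apply Rmult_le_pos; [apply Rabs_pos|left; apply exp_pos].
      - apply Rmult_le_compat; try apply Rabs_pos; try easy. left; apply exp_pos. }
    apply Rle_trans with (Y * exp (- (6 / 10 * (Y * Y)))).
    { pose proof (exp_pos (- (6 / 10 * (Y * Y)))).
      replace ((beta + X / 2) * _) with
        ((beta + X / 2) * exp (- (beta * X)) * exp (- (6 / 10 * (Y * Y)))) by ring.
      apply Rmult_le_compat_r; lra. }
    (* Half of [Y^2] in the exponent absorbs the factor [Y], and a tenth of it remains as decay. *)
    replace (- (6 / 10 * (Y * Y))) with (- (/ 2 * (Y * Y)) + - (Y * Y / 10)) by field.
    rewrite exp_plus, <- Rmult_assoc. apply Rmult_le_compat_r; [left; apply exp_pos|].
    pose proof (exp_ineq1_le (/ 2 * (Y * Y))). pose proof (exp_pos (/ 2 * (Y * Y))).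
    rewrite exp_Ropp. apply Rmult_le_reg_r with (exp (/ 2 * (Y * Y))); [easy|].
    rewrite Rmult_assoc, Rinv_l by lra. nra. }
  replace (sqrt PI / 2 * exp (- (X * X / 4)) - K 1) with
    ((sqrt PI / 2 - gint Y) * exp (- (X * X / 4)) - D) by (rewrite HK0 in HMVT; lra).
  pose proof (exp_pos (- (X * X / 4))).
  assert (0 <= (sqrt PI / 2 - gint Y) * exp (- (X * X / 4)) <= 2 * exp (- (Y * Y))) by nra.
  apply Rabs_le_between in HD. apply Rabs_le. lra.
Qed.

(** * The complex exponential *)

Lemma Cmod_Im_le (z : C) : Rabs (Im z) <= Cmod z.
Proof. apply Rle_trans with (2 := Rmax_Cmod z). apply Rmax_r. Qed.

Lemma Re_scal_r (z : C) (r : R) : Re (z * r) = Re z * r.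
Proof. destruct z; unfold Re; simpl. ring. Qed.

Lemma Im_scal_r (z : C) (r : R) : Im (z * r) = Im z * r.
Proof. destruct z; unfold Im; simpl. ring. Qed.

Lemma Im_plus (y z : C) : Im (y + z) = Im y + Im z.
Proof. reflexivity. Qed.

Lemma Re_plus (y z : C) : Re (y + z) = Re y + Re z.
Proof. reflexivity. Qed.

Lemma Re_mult_minus (u y z : C) : Re (u * (y - z)) = Re (u * y) - Re (u * z).
Proof. destruct u, y, z. unfold Re; simpl. ring. Qed.

Definition cexp (z : C) : C := (exp (Re z) * cos (Im z), exp (Re z) * sin (Im z)).

Lemma cexp_plus (y z : C) : cexp (y + z) = (cexp y * cexp z)%C.
Proof.
  destruct y as [a b], z as [c d]. unfold cexp, Cmult; simpl.
  rewrite exp_plus, cos_plus, sin_plus. f_equal; ring.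
Qed.

Lemma cexp_0 : cexp 0 = 1%C.
Proof. unfold cexp; simpl. rewrite exp_0, cos_0, sin_0. unfold RtoC. f_equal; ring. Qed.

Lemma Cmod_cexp (z : C) : Cmod (cexp z) = exp (Re z).
Proof.
  unfold Cmod, cexp; simpl.
  replace (_ + _) with (exp (Re z) * exp (Re z)
     * (Rsqr (sin (Im z)) + Rsqr (cos (Im z)))) by (unfold Rsqr; ring).
  rewrite sin2_cos2, Rmult_1_r. apply sqrt_square. left; apply exp_pos.
Qed.

Lemma cexp_conj (z : C) : cexp (Cconj z) = Cconj (cexp z).
Proof.
  destruct z as [a b]. unfold cexp, Cconj; simpl. rewrite cos_neg, sin_neg. f_equal; ring.
Qed.

Fixpoint csum (f : nat -> C) (n : nat) : C :=
  match n with O => 0 | S n => csum f n + f n end.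

Lemma csum_ext (f g : nat -> C) (n : nat) :
  (forall k, (k < n)%nat -> f k = g k) -> csum f n = csum g n.
Proof.
  induction n as [|n IH]; intros H; simpl; [easy|].
  rewrite IH, H; [easy|lia|intros k Hk; apply H; lia].
Qed.

Lemma csum_plus (f g : nat -> C) (n : nat) :
  csum (fun k => f k + g k)%C n = (csum f n + csum g n)%C.
Proof. induction n as [|n IH]; simpl; [|rewrite IH]; ring. Qed.

Lemma csum_mult_l (c : C) (f : nat -> C) (n : nat) :
  csum (fun k => c * f k)%C n = (c * csum f n)%C.
Proof. induction n as [|n IH]; simpl; [|rewrite IH]; ring. Qed.

Lemma csum_exchange (f : nat -> nat -> C) (m n : nat) :
  csum (fun j => csum (f j) n) m = csum (fun k => csum (fun j => f j k) m) n.
Proof.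
  induction m as [|m IH]; simpl.
  - induction n as [|n IH]; simpl; [easy|]. rewrite <- IH. ring.
  - rewrite IH. rewrite <- csum_plus. easy.
Qed.

Lemma Cmod_csum_le (f : nat -> C) (M : R) (n : nat) :
  (forall k, (k < n)%nat -> Cmod (f k) <= M) -> Cmod (csum f n) <= INR n * M.
Proof.
  induction n as [|n IH]; intros H; simpl csum.
  - simpl. rewrite Cmod_0. lra.
  - rewrite S_INR. apply Rle_trans with (1 := Cmod_triangle _ _).
    specialize (H n ltac:(lia)) as Hn.
    assert (Cmod (csum f n) <= INR n * M) by (apply IH; intros; apply H; lia). lra.
Qed.

Lemma csum_single (f : nat -> C) (k n : nat) :
  (k < n)%nat -> (forall j, (j < n)%nat -> j <> k -> f j = 0) -> csum f n = f k.
Proof.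
  intros Hk H. induction n as [|n IH]; [lia|]. simpl.
  destruct (Nat.eq_dec k n) as [->|Hne].
  - rewrite (csum_ext f (fun _ => 0 * 0)%C); [rewrite csum_mult_l; ring|].
    intros j Hj. rewrite H by lia. ring.
  - rewrite IH, (H n) by (try lia; intros; apply H; lia). ring.
Qed.

(** * Taylor remainder of the complex exponential *)

Definition exp_taylor (N : nat) (w : C) : C :=
  csum (fun k => w ^ k * / INR (fact k))%C N.

Definition exp_rem (N : nat) (w : C) : C := (cexp w - exp_taylor N w)%C.

Lemma Cpow_RtoC_mult (s : R) (w : C) (k : nat) :
  ((s * w) ^ k = w ^ k * (s ^ k)%R)%C.
Proof.
  induction k as [|k IH]; [simpl; ring|]. cbn [Cpow pow].
  rewrite IH, RtoC_mult. ring.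
Qed.

(** Taking real parts after multiplication by a fixed [u] reduces complex differentiation along the
    segment from 0 to [w] to real differentiation. *)
Lemma is_derive_exp_taylor (u w : C) (N : nat) (s : R) :
  is_derive (fun s : R => Re (u * exp_taylor (S N) (s * w))) s
    (Re (u * w * exp_taylor N (s * w))).
Proof.
  induction N as [|N IH].
  - apply (is_derive_ext (fun _ => Re u)).
    { intros t. unfold exp_taylor; simpl csum. f_equal. change (INR (fact 0)) with 1. simpl Cpow. field. }
    change (exp_taylor 0 (s * w)) with (RtoC 0). rewrite Cmult_0_r.
    apply (is_derive_const (V := R_NormedModule)).
  - apply (is_derive_ext (fun s : R => Re (u * exp_taylor (S N) (s * w))
       + Re (u * w ^ (S N)) * (s ^ (S N) * / INR (fact (S N))))).
    { intros t. change (exp_taylor (S (S N)) (t * w)) with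
        (exp_taylor (S N) (t * w) + (t * w) ^ (S N) * / INR (fact (S N)))%C.
      rewrite Cpow_RtoC_mult, Cmult_plus_distr_l, Re_plus. f_equal.
      rewrite <- Re_scal_r, RtoC_mult, RtoC_inv by apply INR_fact_neq_0. f_equal. ring. }
    change (exp_taylor (S N) (s * w)) with
        (exp_taylor N (s * w) + (s * w) ^ N * / INR (fact N))%C.
    rewrite Cpow_RtoC_mult, Cmult_plus_distr_l, Re_plus.
    apply (is_derive_plus (V := R_NormedModule) (fun s : R => Re (u * exp_taylor (S N) (s * w)))); [exact IH|].
    assert (Hf : INR (fact N) <> 0) by apply INR_fact_neq_0.
    assert (HN : INR (S N) <> 0) by (apply not_0_INR; lia).
    replace (Re (u * w * (w ^ N * (s ^ N)%R * / INR (fact N))))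
      with (Re (u * w ^ S N) * (s ^ N * / INR (fact N))).
    2:{ rewrite <- Re_scal_r, RtoC_mult, RtoC_inv by easy. f_equal. simpl. ring. }
    assert (HF : INR (fact (S N)) = INR (S N) * INR (fact N))
      by (rewrite <- mult_INR; reflexivity).
    rewrite HF. set (F := INR (fact N)) in *. set (v := Re _).
    auto_derive; [easy|]. change (pred (S N)) with N.
    change (match N with O => 1 | S _ => INR N + 1 end) with (INR (S N)).
    field. easy.
Qed.

Lemma is_derive_cexp (u w : C) (s : R) :
  is_derive (fun s : R => Re (u * cexp (s * w))) s (Re (u * w * cexp (s * w))).
Proof.
  destruct u as [u1 u2], w as [w1 w2]. unfold cexp, Cmult, Re, Im; simpl.
  auto_derive; [easy|]. unfold Rminus. ring.
Qed.

(** Induction on [N]: along the segment [s * w], the derivative of the remainder of order [S N] is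
    [w] times that of order [N], and the bound satisfies the same recursion because the factor
    [exp 1] in the exponent raises [exp (- INR (S N))] to [exp (- INR N)]. *)
Lemma exp_rem_bound (N : nat) (w : C) :
  Cmod (exp_rem N w) <= exp (- INR N) * exp (exp 1 * Cmod w).
Proof.
  revert w. induction N as [|N IH]; intros w.
  - unfold exp_rem, exp_taylor. simpl csum.
    replace (cexp w - 0)%C with (cexp w) by ring.
    rewrite Cmod_cexp, <- exp_plus. apply exp_le. simpl.
    pose proof (re_le_Cmod w). pose proof (Rle_abs (Re w)). pose proof (Cmod_ge_0 w).
    pose proof (exp_ineq1_le 1). nra.
  - set (z := exp_rem (S N) w).
    (* Pairing with the conjugate of [z] gives a real function whose value at 1 is [Cmod z] times
       the difference between [Cmod z] and the claimed bound, so it suffices that [phi] starts and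
       stays nonpositive at 1. *)
    pose (phi := fun s : R => Re (Cconj z * cexp (s * w))
                  - Re (Cconj z * exp_taylor (S N) (s * w))
                  - Cmod z * (exp (- INR (S N)) * exp (exp 1 * (s * Cmod w)))).
    pose (dphi := fun s : R => Re (Cconj z * w * cexp (s * w))
                  - Re (Cconj z * w * exp_taylor N (s * w))
                  - Cmod z * (Cmod w * (exp (- INR N) * exp (exp 1 * (s * Cmod w))))).
    assert (Hd : forall s, is_derive phi s (dphi s)).
    { intros s. unfold phi, dphi.
      apply (is_derive_minus (V := R_NormedModule)
         (fun s : R => Re (Cconj z * cexp (s * w)) - Re (Cconj z * exp_taylor (S N) (s * w)))).
      - apply (is_derive_minus (V := R_NormedModule) (fun s : R => Re (Cconj z * cexp (s * w)))).
        + apply is_derive_cexp.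
        + apply is_derive_exp_taylor.
      - replace (- INR N) with (- INR (S N) + 1) by (rewrite S_INR; ring).
        rewrite exp_plus. set (F := exp (- INR (S N))). auto_derive; [easy|]. ring. }
    destruct (MVT_gen phi 0 1 dphi) as [c [Hc HM]].
    { intros; apply Hd. }
    { intros. eapply is_derive_continuity_pt, Hd. }
    rewrite Rmin_left, Rmax_right in Hc by lra.
    assert (Hneg : dphi c <= 0).
    { unfold dphi. set (m := Cmod z).
      assert (Hre : Re (Cconj z * w * cexp (c * w)) - Re (Cconj z * w * exp_taylor N (c * w))
         = Re (Cconj z * w * exp_rem N (c * w))).
      { symmetry. apply Re_mult_minus. }
      rewrite Hre.
      pose proof (Rle_trans _ _ _ (Rle_abs _) (re_le_Cmod (Cconj z * w * exp_rem N (c * w)))) as H1.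
      rewrite !Cmod_mult, Cmod_conj in H1. fold m in H1.
      specialize (IH (c * w)%C). rewrite Cmod_mult, Cmod_R, (Rabs_pos_eq c) in IH by lra.
      pose proof (Cmod_ge_0 z). fold m in H. pose proof (Cmod_ge_0 w).
      assert (m * Cmod w * Cmod (exp_rem N (c * w)) <=
        m * Cmod w * (exp (- INR N) * exp (exp 1 * (c * Cmod w))))
        by (apply Rmult_le_compat_l; [nra|exact IH]). lra. }
    assert (H0 : phi 0 <= 0).
    { unfold phi. rewrite !Cmult_0_l, cexp_0.
      assert (Ht : exp_taylor (S N) 0 = 1%C).
      { unfold exp_taylor. rewrite (csum_single _ 0); [simpl|lia|].
        - field.
        - intros [|j] _ Hj; [easy|]. simpl. ring. }
      rewrite Ht. pose proof (Cmod_ge_0 z).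
      pose proof (exp_pos (- INR (S N))). pose proof (exp_pos (exp 1 * (0 * Cmod w))).
      assert (0 <= Cmod z * (exp (- INR (S N)) * exp (exp 1 * (0 * Cmod w)))).
      { apply Rmult_le_pos; [easy|]. left. now apply Rmult_lt_0_compat. }
      lra. }
    assert (H1 : phi 1 <= 0) by lra.
    assert (Hz : Re (Cconj z * cexp (1 * w)) - Re (Cconj z * exp_taylor (S N) (1 * w))
       = Cmod z * Cmod z).
    { rewrite Cmult_1_l. replace (Cmod z * Cmod z) with (Re (RtoC (Cmod z ^ 2)))
        by (simpl; ring).
      rewrite Cmod2_conj, (Cmult_comm z).
      symmetry. apply Re_mult_minus. }
    unfold phi in H1. rewrite Hz, (Rmult_1_l (Cmod w)) in H1.
    pose proof (Cmod_ge_0 z) as [Hp|Hp].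
    + apply Rmult_le_reg_l with (Cmod z); [easy|]. lra.
    + rewrite <- Hp. left. apply Rmult_lt_0_compat; apply exp_pos.
Qed.

(** * Quadrature on one panel *)

(** A quadrature rule is a list of pairs (weight, node), so that rules can be concatenated, rescaled
    and conjugated as lists. *)
Definition lsum (rule : list (C * C)) (F : C -> C) : C :=
  fold_right (fun p acc => fst p * F (snd p) + acc)%C (RtoC 0) rule.

Lemma lsum_app (r1 r2 : list (C * C)) (F : C -> C) :
  lsum (r1 ++ r2) F = (lsum r1 F + lsum r2 F)%C.
Proof. induction r1 as [|p r IH]; simpl; [|rewrite IH]; ring. Qed.

Lemma lsum_ext (r : list (C * C)) (F G : C -> C) :
  (forall p, In p r -> F (snd p) = G (snd p)) -> lsum r F = lsum r G.
Proof.
  induction r as [|p r IH]; intros H; simpl; [easy|].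
  rewrite H by now left. rewrite IH; [easy|]. intros q Hq. apply H. now right.
Qed.

Lemma lsum_plus (r : list (C * C)) (F G : C -> C) :
  lsum r (fun u => F u + G u)%C = (lsum r F + lsum r G)%C.
Proof. induction r as [|p r IH]; simpl; [|rewrite IH]; ring. Qed.

Lemma lsum_mult_l (c : C) (r : list (C * C)) (F : C -> C) :
  lsum r (fun u => c * F u)%C = (c * lsum r F)%C.
Proof. induction r as [|p r IH]; simpl; [|rewrite IH]; ring. Qed.

Lemma Cmod_lsum_le (r : list (C * C)) (F : C -> C) (W M : R) : 0 <= W ->
  (forall p, In p r -> Cmod (fst p) <= W /\ Cmod (F (snd p)) <= M) ->
  Cmod (lsum r F) <= INR (length r) * (W * M).
Proof.
  intros HW. induction r as [|p r IH]; intros H; simpl lsum.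
  - simpl. rewrite Cmod_0. lra.
  - cbn [length]. rewrite S_INR. apply Rle_trans with (1 := Cmod_triangle _ _).
    destruct (H p (or_introl eq_refl)) as [H1 H2].
    assert (Cmod (lsum r F) <= INR (length r) * (W * M))
      by (apply IH; intros q Hq; apply H; now right).
    rewrite Cmod_mult.
    assert (Cmod (fst p) * Cmod (F (snd p)) <= W * M)
      by (apply Rmult_le_compat; try apply Cmod_ge_0; easy). lra.
Qed.

Lemma lsum_map (c : C) (b : C -> C) (r : list (C * C)) (F : C -> C) :
  lsum (map (fun p => (c * fst p, b (snd p)))%C r) F = (c * lsum r (fun u => F (b u)))%C.
Proof. induction r as [|p r IH]; simpl; [|rewrite IH]; ring. Qed.

Lemma lsum_map_seq (w u : nat -> C) (F : C -> C) (k n : nat) :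
  lsum (map (fun j => (w j, u j)) (seq 0 n)) F = csum (fun j => w j * F (u j))%C n.
Proof.
  induction n as [|n IH]; [easy|].
  rewrite seq_S, map_app, lsum_app, IH. simpl. ring.
Qed.

(** * Roots of unity and moments *)

Definition Cis (x : R) : C := (cos x, sin x).

Lemma Cis_plus (x y : R) : Cis (x + y) = (Cis x * Cis y)%C.
Proof. unfold Cis, Cmult; simpl. rewrite cos_plus, sin_plus. f_equal; ring. Qed.

Lemma Cis_0 : Cis 0 = 1%C.
Proof. unfold Cis. now rewrite cos_0, sin_0. Qed.

Lemma Cmod_Cis (x : R) : Cmod (Cis x) = 1.
Proof.
  unfold Cmod, Cis; simpl. transitivity (sqrt 1); [f_equal|apply sqrt_1].
  pose proof (sin2_cos2 x). unfold Rsqr in *. lra.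
Qed.

Lemma Cis_pow (x : R) (k : nat) : (Cis x ^ k)%C = Cis (x * INR k).
Proof.
  induction k as [|k IH]; [simpl; rewrite Rmult_0_r, Cis_0; easy|].
  cbn [Cpow]. rewrite IH, <- Cis_plus, S_INR. f_equal. ring.
Qed.

Lemma Cis_neq_1 (y : R) : sin y <> 0 -> Cis (2 * y) <> 1%C.
Proof.
  intros Hs H. apply (f_equal fst) in H. simpl in H.
  rewrite cos_2a_sin in H. apply Hs. nra.
Qed.

Lemma Cis_2PI_INR (k : nat) : Cis (2 * PI * INR k) = 1%C.
Proof.
  rewrite <- Cis_pow. unfold Cis. rewrite cos_2PI, sin_2PI.
  induction k as [|k IH]; [easy|]. cbn [Cpow]. rewrite IH. change (1, 0) with (RtoC 1). ring.
Qed.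

Lemma geometric_csum (z : C) (n : nat) : ((z - 1) * csum (fun j => z ^ j) n = z ^ n - 1)%C.
Proof.
  induction n as [|n IH]; simpl; [ring|]. rewrite Cmult_plus_distr_l, IH. ring.
Qed.

(** The base is an [n]-th root of unity, so the geometric sum vanishes unless the base is 1. This is
    excluded because half its angle lies strictly between 0 and [PI] in absolute value. *)
Lemma roots_of_unity_orthogonal (n k l : nat) : (k < n)%nat -> (l < n)%nat -> k <> l ->
  csum (fun j => Cis (2 * PI * (INR k - INR l) / INR n) ^ j)%C n = 0.
Proof.
  intros Hk Hl Hne. set (z := Cis _).
  assert (Hn : 0 < INR n) by (apply lt_0_INR; lia).
  assert (Hz : z <> 1%C).
  { unfold z. replace (2 * PI * (INR k - INR l) / INR n) with
      (2 * (PI * ((INR k - INR l) / INR n))) by (field; lra).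
    apply Cis_neq_1. apply lt_INR in Hk, Hl.
    pose proof (pos_INR k). pose proof (pos_INR l). pose proof PI_RGT_0.
    assert (Hr : forall p q : nat, (p < q)%nat -> INR q < INR n ->
      0 < sin (PI * ((INR q - INR p) / INR n))).
    { intros p q Hpq Hq. apply lt_INR in Hpq. pose proof (pos_INR p).
      assert (0 < (INR q - INR p) / INR n) by (apply Rdiv_lt_0_compat; lra).
      assert ((INR q - INR p) / INR n < 1).
      { apply Rmult_lt_reg_r with (INR n); [easy|].
        unfold Rdiv. rewrite Rmult_assoc, Rinv_l; lra. }
      apply sin_gt_0; nra. }
    destruct (Nat.lt_ge_cases k l) as [Hkl|Hkl].
    - specialize (Hr k l Hkl Hl).
      replace (PI * ((INR k - INR l) / INR n)) with (- (PI * ((INR l - INR k) / INR n)))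
        by (field; lra). rewrite sin_neg. lra.
    - specialize (Hr l k ltac:(lia) Hk). lra. }
  pose proof (geometric_csum z n) as Hg.
  assert (Hzn : (z ^ n = 1)%C).
  { unfold z. rewrite Cis_pow.
    replace (2 * PI * (INR k - INR l) / INR n * INR n) with
      (2 * PI * INR k + - (2 * PI * INR l)) by (field; lra).
    rewrite Cis_plus, Cis_2PI_INR.
    pose proof (Cis_plus (2 * PI * INR l) (- (2 * PI * INR l))) as Hp.
    rewrite Rplus_opp_r, Cis_0, Cis_2PI_INR in Hp. now rewrite <- Hp. }
  rewrite Hzn in Hg.
  assert (Hz1 : (z - 1 <> 0)%C).
  { intros H. apply Hz. replace z with ((z - 1) + 1)%C by ring. rewrite H. ring. }
  replace (csum (fun j => z ^ j)%C n) with (/ (z - 1) * ((z - 1) * csum (fun j => z ^ j) n))%C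
    by (field; exact Hz1).
  rewrite Hg. ring.
Qed.

Definition moment (l : nat) : R := (1 - (-1) ^ S l) / INR (S l).

Lemma is_RInt_moment (l : nat) : is_RInt (fun u => u ^ l) (-1) 1 (moment l).
Proof.
  assert (HS : INR (S l) <> 0) by (apply not_0_INR; lia).
  assert (Hm : moment l = 1 ^ S l / INR (S l) - (-1) ^ S l / INR (S l))
    by (unfold moment; rewrite pow1; field; easy).
  rewrite Hm.
  apply (is_RInt_derive (V := R_CompleteNormedModule) (fun u => u ^ S l / INR (S l))).
  - intros u _. set (c := INR (S l)) in *.
    apply (is_derive_ext (fun u => / c * u ^ S l)); [intros v; apply Rmult_comm|].
    replace (u ^ l) with (/ c * (c * u ^ l)) by (field; easy).
    apply (is_derive_scal (fun u => u ^ S l)). apply is_derive_Reals.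
    apply (derivable_pt_lim_pow u (S l)).
  - intros u _. apply continuity_pt_filterlim.
    apply derivable_continuous_pt, derivable_pt_pow.
Qed.

Lemma moment_bound (l : nat) : Rabs (moment l) <= 2.
Proof.
  unfold moment. assert (H : 1 <= INR (S l)) by (rewrite S_INR; pose proof (pos_INR l); lra).
  assert (Hp : Rabs ((-1) ^ S l) <= 1) by (rewrite pow_1_abs; lra).
  apply Rabs_le_between in Hp.
  unfold Rdiv. rewrite Rabs_mult, Rabs_inv, (Rabs_pos_eq (INR _)) by lra.
  apply Rmult_le_reg_r with (INR (S l)); [lra|].
  rewrite Rmult_assoc, Rinv_l, Rmult_1_r by lra.
  assert (Rabs (1 - (-1) ^ S l) <= 2) by (apply Rabs_le; lra). lra.
Qed.

(* Discrete Cauchy formula: averaging [P u * u^{-l}] over the [n]-th roots of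
   unity extracts the [l]-th coefficient of a polynomial of degree below [n]. *)
Lemma circle_rule (n : nat) : (0 < n)%nat -> exists rule : list (C * C),
  length rule = n /\
  (forall p, In p rule -> Cmod (fst p) <= 2 /\ Cmod (snd p) = 1) /\
  forall k, (k < n)%nat -> lsum rule (fun u => u ^ k)%C = moment k.
Proof.
  intros Hn. assert (HR : 0 < INR n) by now apply lt_0_INR.
  set (th := fun j : nat => 2 * PI * INR j / INR n).
  (* These weights integrate over [-1, 1] the polynomial interpolating at the roots of unity. Their
     modulus is at most 2, since they average [n] terms bounded by [moment_bound]. *)
  set (w := fun j : nat =>
    (/ INR n * csum (fun l => moment l * Cis (- (th j * INR l))) n)%C).
  exists (map (fun j => (w j, Cis (th j))) (seq 0 n)).
  split; [|split].
  - now rewrite length_map, length_seq.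
  - intros p Hp. apply in_map_iff in Hp. destruct Hp as [j [<- _]]. simpl.
    split; [|apply Cmod_Cis]. unfold w.
    rewrite Cmod_mult, Cmod_inv, Cmod_R, Rabs_pos_eq.
    + apply Rmult_le_reg_l with (INR n); [easy|].
      rewrite <- Rmult_assoc, Rinv_r, Rmult_1_l by lra.
      apply Cmod_csum_le. intros l _. rewrite Cmod_mult, Cmod_R, Cmod_Cis, Rmult_1_r.
      apply moment_bound.
    + lra.
    + intros H. apply RtoC_inj in H. lra.
  - intros k Hk. rewrite lsum_map_seq by exact 0%nat.
    rewrite (csum_ext _ (fun j => / INR n *
      csum (fun l => moment l * Cis (2 * PI * (INR k - INR l) / INR n) ^ j) n)%C).
    2:{ intros j _. unfold w. rewrite <- Cmult_assoc. f_equal.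
        rewrite Cmult_comm, <- csum_mult_l. apply csum_ext. intros l _.
        rewrite !Cis_pow, Cmult_assoc, (Cmult_comm _ (moment l)), <- Cmult_assoc, <- Cis_plus.
        do 2 f_equal. unfold th. field. lra. }
    rewrite csum_mult_l, csum_exchange.
    rewrite (csum_single _ k); [|easy|].
    + replace (2 * PI * (INR k - INR k) / INR n) with 0 by (field; lra).
      rewrite Cis_0, csum_mult_l.
      assert (H1 : forall m, csum (fun j => 1 ^ j)%C m = INR m).
      { induction m as [|m IHm]; [easy|]. cbn [csum]. rewrite IHm, S_INR, RtoC_plus.
        f_equal. clear. induction m as [|m IH]; [easy|]. cbn [Cpow]. rewrite IH. ring. }
      rewrite H1. field. intros H. apply RtoC_inj in H. lra.
    + intros l Hl Hne. rewrite csum_mult_l, roots_of_unity_orthogonal by (trivial; lia).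
      ring.
Qed.

(** Polynomial functions of degree below [d], generated by closure properties so that exactness
    follows by induction without coefficients. [Cpoly_ext] stands in for functional
    extensionality. *)
Inductive Cpoly : nat -> (C -> C) -> Prop :=
| Cpoly_pow d k : (k < d)%nat -> Cpoly d (fun u => u ^ k)%C
| Cpoly_plus d f g : Cpoly d f -> Cpoly d g -> Cpoly d (fun u => f u + g u)%C
| Cpoly_scal d c f : Cpoly d f -> Cpoly d (fun u => c * f u)%C
| Cpoly_ext d f g : (forall u, f u = g u) -> Cpoly d f -> Cpoly d g.

Lemma Cpoly_le (d d' : nat) (f : C -> C) : (d <= d')%nat -> Cpoly d f -> Cpoly d' f.
Proof.
  intros Hd H. induction H.
  - apply Cpoly_pow. lia.
  - apply Cpoly_plus; auto.
  - apply Cpoly_scal; auto.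
  - apply (Cpoly_ext _ f); auto.
Qed.

Lemma Cpoly_mult_X (d : nat) (f : C -> C) : Cpoly d f -> Cpoly (S d) (fun u => u * f u)%C.
Proof.
  intros H. induction H.
  - apply (Cpoly_ext _ (fun u => u ^ S k)%C); [easy|]. apply Cpoly_pow. lia.
  - apply (Cpoly_ext _ (fun u => u * f u + u * g u)%C); [intros; ring|].
    now apply Cpoly_plus.
  - apply (Cpoly_ext _ (fun u => c * (u * f u))%C); [intros; ring|]. now apply Cpoly_scal.
  - apply (Cpoly_ext _ (fun u => u * f u)%C); [intros; now rewrite H|easy].
Qed.

Lemma Cpoly_quadratic_pow (A B : C) (k : nat) :
  Cpoly (2 * k + 1) (fun u => (A * u + B * (u * u)) ^ k)%C.
Proof.
  induction k as [|k IH].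
  - apply (Cpoly_pow _ 0). lia.
  - apply (Cpoly_ext _ (fun u => A * (u * (A * u + B * (u * u)) ^ k)
       + B * (u * (u * (A * u + B * (u * u)) ^ k)))%C).
    { intros u. simpl. ring. }
    replace (2 * S k + 1)%nat with (S (S (2 * k + 1))) by lia.
    apply Cpoly_plus; apply Cpoly_scal.
    + apply (Cpoly_le (S (2 * k + 1))); [lia|]. now apply Cpoly_mult_X.
    + now apply Cpoly_mult_X, Cpoly_mult_X.
Qed.

(** The powers go up to [N - 1] and their argument is quadratic, so the degree is at most [2 N - 2];
    this is why [2 N] nodes are used per panel. *)
Lemma Cpoly_exp_taylor (A B : C) (N : nat) :
  (0 < N)%nat -> Cpoly (2 * N) (fun u => exp_taylor N (A * u + B * (u * u)))%C.
Proof.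
  intros HN. unfold exp_taylor.
  assert (H : forall m, (m <= N)%nat -> Cpoly (2 * N)
    (fun u => csum (fun k => (A * u + B * (u * u)) ^ k * / INR (fact k)) m)%C).
  { induction m as [|m IH]; intros Hm.
    - apply (Cpoly_ext _ (fun u => 0 * u ^ 0)%C); [intros; simpl; ring|].
      apply Cpoly_scal, Cpoly_pow. lia.
    - apply (Cpoly_plus _ (fun u => csum (fun k => (A * u + B * (u * u)) ^ k * / INR (fact k)) m)%C).
      + apply IH. lia.
      + apply (Cpoly_ext _ (fun u => / INR (fact m) * (A * u + B * (u * u)) ^ m)%C);
          [intros; ring|].
        apply Cpoly_scal. apply (Cpoly_le (2 * m + 1)); [lia|]. apply Cpoly_quadratic_pow. }
  now apply H.
Qed.

(** [D] is generalised in the induction: imaginary parts do not commute with a complex scalar [c],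
    which is therefore absorbed into [D]. *)
Lemma rule_exact (rule : list (C * C)) (n : nat) (f : C -> C) :
  (forall k, (k < n)%nat -> lsum rule (fun u => u ^ k)%C = moment k) -> Cpoly n f ->
  forall D, is_RInt (fun u : R => Im (D * f u)) (-1) 1 (Im (D * lsum rule f)).
Proof.
  intros Hr H. induction H; intros D.
  - rewrite Hr by easy. rewrite Im_scal_r.
    apply (is_RInt_ext (fun u : R => scal (Im D) (u ^ k))).
    { intros u _. now rewrite <- RtoC_pow, Im_scal_r. }
    apply (is_RInt_scal (V := R_NormedModule)), is_RInt_moment.
  - rewrite lsum_plus, Cmult_plus_distr_l, Im_plus.
    apply (is_RInt_ext (fun u : R => plus (Im (D * f u)) (Im (D * g u)))).
    { intros u _. now rewrite Cmult_plus_distr_l, Im_plus. }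
    apply (is_RInt_plus (V := R_NormedModule)); auto.
  - rewrite lsum_mult_l, Cmult_assoc.
    apply (is_RInt_ext (fun u : R => Im (D * c * f u))); [|auto].
    intros u _. now rewrite Cmult_assoc.
  - rewrite <- (lsum_ext _ f) by auto.
    apply (is_RInt_ext (fun u : R => Im (D * f u))); [|auto].
    intros u _. now rewrite H.
Qed.

(** The Taylor part is integrated exactly. The remainder is small on the closed unit disc, which
    contains both the interval and the nodes: the 2 is the length of the interval, and [4 N] comes
    from [2 N] nodes of weight at most 2. *)
Lemma panel_error (N : nat) (rule : list (C * C)) (A B D : C) (l : R) : (0 < N)%nat ->
  length rule = (2 * N)%nat ->
  (forall p, In p rule -> Cmod (fst p) <= 2 /\ Cmod (snd p) = 1) ->
  (forall k, (k < 2 * N)%nat -> lsum rule (fun u => u ^ k)%C = moment k) ->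
  is_RInt (fun u : R => Im (D * cexp (A * u + B * (u * u)))) (-1) 1 l ->
  Rabs (l - Im (D * lsum rule (fun u => cexp (A * u + B * (u * u)))))
  <= Cmod D * (2 + 4 * INR N) * (exp (- INR N) * exp (exp 1 * (Cmod A + Cmod B))).
Proof.
  intros HN Hlen Hr Hex Hl.
  set (eps := exp (- INR N) * exp (exp 1 * (Cmod A + Cmod B))).
  set (T := fun u => exp_taylor N (A * u + B * (u * u))).
  set (E := fun u => exp_rem N (A * u + B * (u * u))).
  assert (HE : forall u, Cmod u <= 1 -> Cmod (E u) <= eps).
  { intros u Hu. apply Rle_trans with (1 := exp_rem_bound _ _).
    apply Rmult_le_compat_l; [left; apply exp_pos|]. apply exp_le.
    apply Rmult_le_compat_l; [left; apply exp_pos|].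
    apply Rle_trans with (1 := Cmod_triangle _ _). rewrite !Cmod_mult.
    pose proof (Cmod_ge_0 A). pose proof (Cmod_ge_0 B). pose proof (Cmod_ge_0 u).
    apply Rplus_le_compat; [nra|]. assert (Cmod u * Cmod u <= 1) by nra. nra. }
  assert (HTE : forall u, cexp (A * u + B * (u * u)) = (T u + E u)%C)
    by (intros u; unfold T, E, exp_rem; ring).
  rewrite (lsum_ext _ _ (fun u => T u + E u)%C) by (intros; apply HTE).
  rewrite lsum_plus, Cmult_plus_distr_l, Im_plus.
  pose proof (rule_exact rule (2 * N) T Hex (Cpoly_exp_taylor A B N HN) D) as HT.
  assert (HI : is_RInt (fun u : R => Im (D * E u)) (-1) 1 (minus l (Im (D * lsum rule T)))).
  { apply (is_RInt_ext (fun u : R => minus (Im (D * cexp (A * u + B * (u * u)))) (Im (D * T u))));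
      [|apply (is_RInt_minus (V := R_NormedModule)); [exact Hl|exact HT]].
    intros u _. rewrite HTE, Cmult_plus_distr_l, Im_plus. unfold minus, plus, opp; simpl. ring. }
  assert (H1 : Rabs (minus l (Im (D * lsum rule T))) <= (1 - -1) * (Cmod D * eps)).
  { refine (norm_RInt_le_const (V := R_NormedModule) _ _ _ _ _ _ _ HI); [lra|].
    intros u Hu. apply Rle_trans with (1 := Cmod_Im_le _). rewrite Cmod_mult.
    apply Rmult_le_compat_l; [apply Cmod_ge_0|]. apply HE. rewrite Cmod_R. now apply Rabs_le. }
  assert (H2 : Rabs (Im (D * lsum rule E)) <= Cmod D * (INR (2 * N) * (2 * eps))).
  { apply Rle_trans with (1 := Cmod_Im_le _). rewrite Cmod_mult.
    apply Rmult_le_compat_l; [apply Cmod_ge_0|]. rewrite <- Hlen.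
    apply Cmod_lsum_le; [lra|]. intros p Hp. destruct (Hr p Hp) as [Hp1 Hp2].
    split; [easy|]. apply HE. lra. }
  replace (l - (_ + _)) with (minus l (Im (D * lsum rule T)) + - Im (D * lsum rule E))
    by (unfold minus, plus, opp; simpl; ring).
  apply Rle_trans with (1 := Rabs_triang _ _). rewrite Rabs_Ropp.
  rewrite mult_INR in H2. change (INR 2) with 2 in H2. lra.
Qed.

(** * Geometric panels *)

(** Direction of the ray: its real part is positive and its square has real part -3/4, so that both
    [exp (- z X)] and [exp (z^2)] decay. *)
Definition slope : C := (/ 2, 1).

Lemma Cmod_slope : Cmod slope <= 3 / 2.
Proof.
  unfold Cmod, slope; simpl. rewrite <- (sqrt_square (3 / 2)) by lra.
  apply sqrt_le_1_alt. lra.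
Qed.

Lemma line_integrand_Im (X a v : R) :
  line_integrand X a (/ 2) v =
  Im (slope * cexp ((a + slope * v) * (a + slope * v) - (a + slope * v) * X)).
Proof.
  unfold line_integrand, slope, cexp, Re, Im; simpl.
  match goal with |- exp ?p * (_ * sin ?q + cos ?q) = _ * (exp ?p' * sin ?q') + _ =>
    replace p' with p by field; replace q' with q by field end. ring.
Qed.

(** Rules list scale-free nodes [z], and the scale [a] enters only here; thus one rule serves every
    [a], hence every time. *)
Definition heat_exp (a X : R) (z : C) : C := cexp (a * z * (a * z) - a * z * X).

(** In the panel variable [u] the exponent is a constant plus [A u + B u^2]. The half-width is a
    hundredth of [1 + V], small enough for the decay of the constant term to dominate the factor
    [exp (exp 1 * (Cmod A + Cmod B))] uniformly in [X]. *)
Lemma panel_rule (V : R) (N : nat) : 0 <= V -> (0 < N)%nat ->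
  exists rule : list (C * C), length rule = (2 * N)%nat /\
    (forall p, In p rule -> 0 < Re (snd p)) /\
    forall a X, 0 < a -> 0 <= X ->
      Rabs (RInt (line_integrand X a (/ 2)) (a * (V - (1 + V) / 100)) (a * (V + (1 + V) / 100))
            - Im (a * lsum rule (heat_exp a X)))
      <= / 50 * exp (6 * (a * a)) * ((2 + 4 * INR N) * exp (- INR N)).
Proof.
  intros HV HN. destruct (circle_rule (2 * N) ltac:(lia)) as [r [Hlen [Hr Hex]]].
  set (m := 1 + V). set (h := m / 100). pose proof Cmod_slope as Hs.
  pose proof (Cmod_ge_0 slope) as Hs0.
  exists (map (fun p => (slope * h * fst p, 1 + slope * (V + h * snd p)))%C r).
  split; [now rewrite length_map|]. split.
  - intros p Hp. apply in_map_iff in Hp. destruct Hp as [q [<- Hq]]. cbn [snd].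
    destruct (Hr q Hq) as [_ Hq1].
    assert (H1 : Rabs (Re (slope * snd q)) <= 3 / 2).
    { apply Rle_trans with (1 := re_le_Cmod _). rewrite Cmod_mult, Hq1. lra. }
    apply Rabs_le_between in H1.
    replace (Re _) with (1 + V / 2 + h * Re (slope * snd q)).
    + unfold h, m. nra.
    + destruct (snd q). unfold slope, Re; simpl. field.
  - intros a X Ha HX.
    set (z := (a * (1 + slope * V))%C).
    set (A := ((2 * z - X) * (a * h * slope))%C).
    set (B := (a * h * slope * (a * h * slope))%C).
    set (D := (a * h * slope * cexp (z * z - z * X))%C).
    assert (HI : is_RInt (fun u : R => Im (D * cexp (A * u + B * (u * u)))) (-1) 1
       (RInt (line_integrand X a (/ 2)) (a * (V - h)) (a * (V + h)))).
    { apply (is_RInt_ext (fun u : R =>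
         scal (a * h) (line_integrand X a (/ 2) (a * h * u + a * V)))).
      - intros u _. rewrite line_integrand_Im. unfold D.
        match goal with |- scal ?k (Im ?w) = _ => change (scal k (Im w)) with (k * Im w);
          transitivity (Im (w * RtoC k)); [rewrite Im_scal_r; apply Rmult_comm|f_equal] end.
        rewrite <- (Cmult_assoc (a * h * slope)), <- cexp_plus.
        rewrite !RtoC_plus, !RtoC_mult.
        match goal with |- (_ * cexp ?p * _ = _ * cexp ?q)%C => replace q with p end.
        + ring.
        + unfold A, B, z. ring.
      - apply (is_RInt_comp_lin (V := R_NormedModule)).
        replace (a * h * -1 + a * V) with (a * (V - h)) by ring.
        replace (a * h * 1 + a * V) with (a * (V + h)) by ring.
        apply (RInt_correct (V := R_CompleteNormedModule)).
        apply ex_RInt_continuity, line_integrand_continuity. }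
    pose proof (panel_error N r A B D _ HN Hlen Hr Hex HI) as HP.
    replace (Im (a * lsum _ (heat_exp a X)))
      with (Im (D * lsum r (fun u => cexp (A * u + B * (u * u))))).
    2:{ f_equal. rewrite (lsum_map (slope * h) (fun u => 1 + slope * (V + h * u))%C).
        rewrite <- !lsum_mult_l. apply lsum_ext. intros p _. unfold D, heat_exp.
        rewrite <- Cmult_assoc, <- cexp_plus.
        match goal with |- (_ * cexp ?p = _ * (_ * cexp ?s))%C =>
          replace s with p end.
        - ring.
        - unfold A, B, z. ring. }
    apply Rle_trans with (1 := HP). clear HP HI.
    assert (Hm : 1 <= m) by (unfold m; lra).
    set (y := a * m). assert (Hy : 0 < y) by (unfold y; nra).
    assert (Hah : Cmod (a * h * slope)%C <= 15 / 1000 * y).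
    { rewrite !Cmod_mult, !Cmod_R, !Rabs_pos_eq by (unfold h; lra).
      replace (15 / 1000 * y) with (a * h * (3 / 2)) by (unfold y, h; field).
      apply Rmult_le_compat_l; [unfold h; nra|easy]. }
    assert (Hz : Cmod z <= 3 / 2 * y).
    { unfold z. rewrite Cmod_mult, Cmod_R, (Rabs_pos_eq a) by lra.
      replace (3 / 2 * y) with (a * (3 / 2 * m)) by (unfold y; field).
      apply Rmult_le_compat_l; [lra|]. apply Rle_trans with (1 := Cmod_triangle _ _).
      rewrite Cmod_1, Cmod_mult, Cmod_R, Rabs_pos_eq by easy. unfold m. nra. }
    pose proof (Cmod_ge_0 (a * h * slope)%C) as Hah0.
    assert (HA : Cmod A <= (3 * y + X) * (15 / 1000 * y)).
    { unfold A. rewrite Cmod_mult. apply Rmult_le_compat; [apply Cmod_ge_0|easy| |easy].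
      apply Rle_trans with (1 := Cmod_triangle _ _).
      rewrite Cmod_opp, Cmod_mult, !Cmod_R, !Rabs_pos_eq by lra. lra. }
    assert (HB : Cmod B <= 15 / 1000 * y * (15 / 1000 * y)).
    { unfold B. rewrite Cmod_mult. now apply Rmult_le_compat. }
    assert (HRe : Re (z * z - z * X) = a * a * ((1 + V / 2) * (1 + V / 2) - V * V)
                                       - a * (1 + V / 2) * X).
    { unfold z, slope, Re; simpl. field. }
    assert (He3 : exp 1 * (Cmod A + Cmod B) <= 3 * (Cmod A + Cmod B)).
    { apply Rmult_le_compat_r; [pose proof (Cmod_ge_0 A); pose proof (Cmod_ge_0 B); lra|].
      apply exp_le_3. }
    (* The terms in [y * X] are absorbed by [- a (1 + V / 2) X]. Of the decay [44 / 100 * y^2],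
       provided by [Hq], less than [14 / 100] is spent on [A] and [B]. In [Hq], [94 / 31] is where
       the quadratic in [V] is largest. *)
    assert (Hexp : Re (z * z - z * X) + exp 1 * (Cmod A + Cmod B)
        <= 6 * (a * a) + - (3 / 10 * (y * y))).
    { rewrite HRe.
      assert (HX1 : 45 / 1000 * y * X <= a * (1 + V / 2) * X).
      { apply Rmult_le_compat_r; [easy|]. unfold y, m. nra. }
      assert (Hq : (1 + V / 2) * (1 + V / 2) - V * V + 44 / 100 * (m * m) <= 6).
      { unfold m. pose proof (Rle_0_sqr (V - 94 / 31)). unfold Rsqr in *. lra. }
      assert (Hq2 : a * a * ((1 + V / 2) * (1 + V / 2) - V * V + 44 / 100 * (m * m)) <= a * a * 6)
        by (apply Rmult_le_compat_l; [nra|easy]).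
      replace (y * y) with (a * a * (m * m)) by (unfold y; ring).
      assert (Hyy : y * y = a * a * (m * m)) by (unfold y; ring).
      assert (0 <= a * a * (m * m)) by (rewrite <- Hyy; nra).
      replace ((3 * y + X) * (15 / 1000 * y)) with (45 / 1000 * (y * y) + 15 / 1000 * y * X)
        in HA by field.
      replace (15 / 1000 * y * (15 / 1000 * y)) with (225 / 1000000 * (y * y)) in HB by field.
      rewrite Hyy in HA, HB. lra. }
    (* The remaining Gaussian decay absorbs the panel length, which is proportional to [y]; the
       bound becomes independent of [V]. *)
    assert (HyE : y * exp (- (3 / 10 * (y * y))) <= 1).
    { rewrite exp_Ropp. pose proof (exp_ineq1_le (3 / 10 * (y * y))).
      apply Rmult_le_reg_r with (exp (3 / 10 * (y * y))); [apply exp_pos|].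
      rewrite Rmult_assoc, Rinv_l by (apply Rgt_not_eq, exp_pos).
      pose proof (Rle_0_sqr (y - 5 / 3)). unfold Rsqr in *. lra. }
    unfold D. rewrite Cmod_mult, Cmod_cexp.
    pose proof (pos_INR N) as HN0. pose proof (exp_pos (- INR N)) as HeN.
    set (E1 := exp (Re (z * z - z * X))).
    set (E2 := exp (exp 1 * (Cmod A + Cmod B))).
    assert (HE : E1 * E2 <= exp (6 * (a * a)) * exp (- (3 / 10 * (y * y)))).
    { unfold E1, E2. rewrite <- !exp_plus. now apply exp_le. }
    replace (Cmod (a * h * slope) * E1 * (2 + 4 * INR N) * (exp (- INR N) * E2))
      with (Cmod (a * h * slope) * (E1 * E2) * ((2 + 4 * INR N) * exp (- INR N))) by ring.
    apply Rmult_le_compat_r; [nra|].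
    apply Rle_trans with (15 / 1000 * y * (exp (6 * (a * a)) * exp (- (3 / 10 * (y * y))))).
    { apply Rmult_le_compat; try easy. unfold E1, E2.
      apply Rmult_le_pos; left; apply exp_pos. }
    pose proof (exp_pos (6 * (a * a))). nra.
Qed.

(* Panel [j] covers [v] with [1 + v] between [(101/99)^j] and [(101/99)^(j+1)]. *)
Lemma ray_rule (J N : nat) : (0 < N)%nat ->
  exists rule : list (C * C), length rule = (2 * N * J)%nat /\
    (forall p, In p rule -> 0 < Re (snd p)) /\
    forall a X, 0 < a -> 0 <= X ->
      Rabs (RInt (line_integrand X a (/ 2)) 0 (a * ((101 / 99) ^ J - 1))
            - Im (a * lsum rule (heat_exp a X)))
      <= INR J * (/ 50 * exp (6 * (a * a)) * ((2 + 4 * INR N) * exp (- INR N))).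
Proof.
  intros HN. induction J as [|J [r [Hlen [Hr Herr]]]].
  - exists nil. split; [simpl; lia|]. split; [easy|]. intros a X _ _.
    simpl. rewrite Rminus_diag, Rmult_0_r.
    rewrite (RInt_point (V := R_CompleteNormedModule)).
    unfold zero; simpl. replace (0 - _) with 0 by ring. rewrite Rabs_R0. lra.
  - set (q := (101 / 99) ^ J). assert (Hq : 1 <= q) by (apply pow_R1_Rle; lra).
    (* The centre [V] is chosen so that [1 + V] diminished or increased by a hundredth is [q] or
       [101 / 99 * q]: the panel starts where the previous one ends. *)
    destruct (panel_rule (100 / 99 * q - 1) N ltac:(lra) HN) as [r' [Hlen' [Hr' Herr']]].
    exists (r ++ r'). split; [rewrite length_app; lia|]. split.
    { intros p Hp. apply in_app_or in Hp. destruct Hp; auto. }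
    intros a X Ha HX. specialize (Herr a X Ha HX). specialize (Herr' a X Ha HX).
    replace (100 / 99 * q - 1 - (1 + (100 / 99 * q - 1)) / 100) with (q - 1) in Herr' by field.
    replace (100 / 99 * q - 1 + (1 + (100 / 99 * q - 1)) / 100) with (101 / 99 * q - 1)
      in Herr' by field.
    fold q in Herr. change ((101 / 99) ^ S J) with (101 / 99 * q).
    rewrite <- (RInt_Chasles (V := R_CompleteNormedModule) _ 0 (a * (q - 1)))
      by (apply ex_RInt_continuity, line_integrand_continuity).
    rewrite lsum_app, Cmult_plus_distr_l, Im_plus, S_INR.
    match goal with |- Rabs (plus ?p ?p' - (?s + ?s')) <= _ =>
      replace (plus p p' - (s + s')) with ((p - s) + (p' - s'))
        by (change (plus p p') with (p + p'); ring) end.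
    apply Rle_trans with (1 := Rabs_triang _ _). lra.
Qed.

(** * The sum of exponentials *)

Definition toCx (z : C) : Cx := mkCx (fst z) (snd z).

(** The imaginary part [2 p q] of the square has the sign of [q] when [p > 0]. With all nodes [z] in
    the right half plane, [s = z^2] thus has principal root [z]. *)
Lemma Cxsqrt_sqr (z : C) : 0 < Re z -> Cxsqrt (toCx (z * z)) = toCx z.
Proof.
  destruct z as [p q]. unfold Re; simpl. intros Hp.
  unfold Cxsqrt, Cxmod, toCx; simpl.
  replace ((p * p - q * q) * (p * p - q * q) + (p * q + q * p) * (p * q + q * p))
    with ((p * p + q * q) * (p * p + q * q)) by ring.
  rewrite sqrt_square by nra.
  replace ((p * p + q * q + (p * p - q * q)) / 2) with (p * p) by field.
  replace ((p * p + q * q - (p * p - q * q)) / 2) with (Rsqr q) by (unfold Rsqr; field).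
  rewrite sqrt_square, sqrt_Rsqr_abs by lra. f_equal.
  destruct (Rlt_dec (p * q + q * p) 0) as [H|H].
  - rewrite Rabs_left by nra. ring.
  - rewrite Rabs_pos_eq by nra. ring.
Qed.

Lemma not_on_cut_sqr (z : C) : 0 < Re z -> ~ on_cut (toCx (z * z)).
Proof.
  destruct z as [p q]. unfold Re, on_cut, toCx; simpl. intros Hp [H1 H2].
  assert (q = 0) by nra. subst q. nra.
Qed.

Lemma Cxsum_toCx (f : nat -> Cx) (g : nat -> C) (n : nat) :
  (forall j, (j < n)%nat -> f j = toCx (g j)) -> Cxsum f n = toCx (csum g n).
Proof.
  induction n as [|n IH]; intros H; simpl; [easy|].
  rewrite IH, H; [easy|lia|intros; apply H; lia].
Qed.

Lemma csum_nth (l : list (C * C)) (d : C * C) (F : C -> C) :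
  csum (fun j => fst (nth j l d) * F (snd (nth j l d)))%C (length l) = lsum l F.
Proof.
  induction l as [|p l IH] using rev_ind; [easy|].
  rewrite lsum_app, <- IH, length_app, Nat.add_1_r. cbn [csum]. f_equal.
  - apply csum_ext. intros k Hk. now rewrite app_nth1.
  - rewrite app_nth2, Nat.sub_diag by lia. simpl. ring.
Qed.

(** Adjoining the conjugate rule yields twice a real part; this is how an imaginary part becomes a
    sum of exponentials. *)
Lemma lsum_conj (r : list (C * C)) (F : C -> C) :
  (forall z, F (Cconj z) = Cconj (F z)) ->
  lsum (map (fun p => (Cconj (fst p), Cconj (snd p))) r) F = Cconj (lsum r F).
Proof.
  intros HF. induction r as [|[w z] r IH]; simpl.
  - unfold Cconj, RtoC; simpl. now rewrite Ropp_0.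
  - rewrite IH, HF. destruct w, (F z), (lsum r F). unfold Cconj, Cmult, Cplus; simpl.
    f_equal; ring.
Qed.

Lemma cexp_heat_conj (t y : R) (z : C) :
  cexp (Cconj z * Cconj z * t - Cconj z * y) = Cconj (cexp (z * z * t - z * y)).
Proof.
  rewrite <- cexp_conj. f_equal. destruct z. unfold Cconj, Cmult, Cminus, Cplus, Copp, RtoC; simpl.
  f_equal; ring.
Qed.

Lemma GA_of_rule (r : list (C * C)) (n : nat) : length r = (2 * n)%nat ->
  (forall p, In p r -> 0 < Re (snd p)) ->
  exists w s, (forall j, (j <= 2 * n)%nat -> ~ on_cut (s j)) /\
    forall x t, GA n w s x t = toCx (lsum r (fun z => cexp (z * z * t - z * Rabs x))).
Proof.
  intros Hlen Hr. set (d := (RtoC 0, RtoC 1)).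
  assert (Hpos : forall j, 0 < Re (snd (nth j r d))).
  { intros j. destruct (Nat.lt_ge_cases j (length r)) as [H|H].
    - apply Hr, nth_In, H.
    - rewrite nth_overflow by easy. simpl. lra. }
  exists (fun j => toCx (fst (nth j r d))),
    (fun j => toCx (snd (nth j r d) * snd (nth j r d))).
  split.
  - intros j _. apply not_on_cut_sqr, Hpos.
  - intros x t. set (F := fun z : C => cexp (z * z * t - z * Rabs x)).
    rewrite <- (csum_nth r d). rewrite Hlen.
    unfold GA. rewrite Nat.add_1_r.
    rewrite (Cxsum_toCx _ (fun j => fst (nth j r d) * F (snd (nth j r d)))%C).
    + cbn [csum]. rewrite (nth_overflow r) by lia. f_equal. simpl. ring.
    + intros j _. rewrite Cxsqrt_sqr by apply Hpos.
      unfold F, Cminus. rewrite cexp_plus.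
      set (z := snd (nth j r d)). set (y := Rabs x).
      destruct (fst (nth j r d)) as [w1 w2], z as [p q].
      unfold toCx, Cxmul, Cxexp, Cxopp, RtoCx, cexp, Cmult, Copp, RtoC, Re, Im; simpl.
      reflexivity.
Qed.

(** * Choice of parameters and final estimate *)

Lemma exp_pow_INR (x : R) (n : nat) : exp x ^ n = exp (INR n * x).
Proof.
  induction n as [|n IH]; [simpl; now rewrite Rmult_0_l, exp_0|].
  rewrite S_INR. simpl pow. rewrite IH, <- exp_plus. f_equal. ring.
Qed.

Lemma exists_INR_between (x : R) : 0 <= x -> exists n : nat, x <= INR n <= x + 1.
Proof.
  intros Hx. destruct (nfloor_ex x Hx) as [n Hn]. exists (S n). rewrite S_INR. lra.
Qed.

(* Precision of the scale-free rule, at time [t = 1]; [exp (- L)] plays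
   the role of [eps / ln (T / delta)]. *)
Lemma unit_time_error (J N : nat) (rule : list (C * C)) (L r a X : R) :
  1000 <= r -> 3 <= L -> 51 * ln r <= INR J <= 52 * ln r -> 16 * L <= INR N ->
  (forall a X, 0 < a -> 0 <= X ->
      Rabs (RInt (line_integrand X a (/ 2)) 0 (a * ((101 / 99) ^ J - 1))
            - Im (a * lsum rule (heat_exp a X)))
      <= INR J * (/ 50 * exp (6 * (a * a)) * ((2 + 4 * INR N) * exp (- INR N)))) ->
  0 < a -> L / r <= a * a <= L -> 0 <= X ->
  Rabs (sqrt PI / 2 * exp (- (X * X / 4)) - Im (a * lsum rule (heat_exp a X)))
  <= 4 * exp (- (10 * L)) + 9 * ln r * exp (- (2 * L)).
Proof.
  intros Hr HL HJ HN Hrule Ha Ha2 HX.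
  set (Y := a * ((101 / 99) ^ J - 1)).
  (* [exp (- (2 / 101)) >= 99 / 101] gives [101 / 99 >= exp (2 / 101)], and [51 * 2 / 101 >= 1]. *)
  assert (Hpow : r <= (101 / 99) ^ J).
  { rewrite <- (exp_ln r) by lra.
    apply Rle_trans with (exp (2 / 101) ^ J).
    - rewrite exp_pow_INR. apply exp_le. lra.
    - apply pow_incr. split; [left; apply exp_pos|].
      pose proof (exp_ineq1_le (- (2 / 101))) as He. rewrite exp_Ropp in He.
      pose proof (exp_pos (2 / 101)) as Hp.
      apply Rmult_le_reg_r with (99 / 101 * / exp (2 / 101)).
      + apply Rmult_lt_0_compat; [lra|]. now apply Rinv_0_lt_compat.
      + replace (exp (2 / 101) * (99 / 101 * / exp (2 / 101))) with (99 / 101)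
          by (field; lra). lra. }
  assert (HY1 : a * (r - 1) <= Y) by (apply Rmult_le_compat_l; lra).
  (* The lower bound on [a * a] makes the ray long enough: [(r - 1)^2 / r >= 100] for
     [r >= 1000]. *)
  assert (HYY : 100 * L <= Y * Y).
  { apply Rle_trans with (a * (r - 1) * (a * (r - 1))).
    - replace (a * (r - 1) * (a * (r - 1))) with (a * a * ((r - 1) * (r - 1))) by ring.
      apply Rle_trans with (L / r * ((r - 1) * (r - 1))).
      + apply Rmult_le_reg_r with r; [lra|].
        replace (L / r * ((r - 1) * (r - 1)) * r) with (L * ((r - 1) * (r - 1)))
          by (field; lra).
        replace (100 * L * r) with (L * (100 * r)) by ring.
        apply Rmult_le_compat_l; nra.
      + apply Rmult_le_compat_r; [nra|lra].
    - apply Rmult_le_compat; nra. }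
  assert (HYa : 10 * a <= Y).
  { apply Rle_trans with (2 := HY1). rewrite (Rmult_comm 10).
    apply Rmult_le_compat_l; lra. }
  assert (HY2 : 2 <= Y) by (apply Rnot_lt_le; intros HY2; nra).
  pose proof (contour_truncation X a Y HX Ha HY2 HYa) as H1.
  specialize (Hrule a X Ha HX). fold Y in Hrule.
  assert (H2 : 4 * exp (- (Y * Y / 10)) <= 4 * exp (- (10 * L))).
  { apply Rmult_le_compat_l; [lra|]. apply exp_le. lra. }
  (* Half of [N >= 16 L] absorbs the polynomial factor, leaving [exp (- (8 * L))], of which
     [exp (6 * L)] pays for the start of the ray; finally [52 * 8 / 50 <= 9]. *)
  assert (H3 : INR J * (/ 50 * exp (6 * (a * a)) * ((2 + 4 * INR N) * exp (- INR N)))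
     <= 9 * ln r * exp (- (2 * L))).
  { assert (Hln : 0 <= ln r) by (pose proof (pos_INR J); lra).
    assert (HeN : (2 + 4 * INR N) * exp (- INR N) <= 8 * exp (- (8 * L))).
    { pose proof (exp_ineq1_le (INR N / 2)) as Hi. pose proof (pos_INR N).
      apply Rle_trans with (8 * exp (- (INR N / 2))).
      - replace (- (INR N / 2)) with (INR N / 2 + - INR N) by field.
        rewrite exp_plus, <- Rmult_assoc.
        apply Rmult_le_compat_r; [left; apply exp_pos|]. lra.
      - apply Rmult_le_compat_l; [lra|]. apply exp_le. lra. }
    assert (Hea : exp (6 * (a * a)) <= exp (6 * L)) by (apply exp_le; lra).
    assert (Hm : exp (6 * (a * a)) * ((2 + 4 * INR N) * exp (- INR N))
       <= exp (6 * L) * (8 * exp (- (8 * L)))).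
    { apply Rmult_le_compat; try easy; [left; apply exp_pos|].
      pose proof (pos_INR N). pose proof (exp_pos (- INR N)). nra. }
    replace (exp (6 * L) * (8 * exp (- (8 * L)))) with (8 * exp (- (2 * L))) in Hm.
    2:{ replace (- (2 * L)) with (6 * L + - (8 * L)) by ring. rewrite exp_plus. ring. }
    pose proof (exp_pos (- (2 * L))).
    apply Rle_trans with (52 * ln r * (/ 50 * (8 * exp (- (2 * L))))).
    - rewrite (Rmult_assoc (/ 50)). apply Rmult_le_compat; try lra.
      apply Rmult_le_pos; [lra|]. apply Rmult_le_pos; [left; apply exp_pos|].
        pose proof (pos_INR N). pose proof (exp_pos (- INR N)). nra.
    - assert (0 <= ln r * exp (- (2 * L))) by (apply Rmult_le_pos; lra). lra. }
  match goal with |- Rabs (?p - ?s) <= _ =>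
    replace (p - s) with ((p - RInt (line_integrand X a (/ 2)) 0 Y)
      + (RInt (line_integrand X a (/ 2)) 0 Y - s)) by ring end.
  apply Rle_trans with (1 := Rabs_triang _ _). lra.
Qed.

(** Parabolic scaling: in the variable [|x| / sqrt t] the kernel is a multiple of the Gaussian
    approximated in [unit_time_error]. *)
Lemma heatG_scaled (x t : R) : 0 < t ->
  heatG x t = / (PI * sqrt t)
    * (sqrt PI / 2 * exp (- (Rabs x / sqrt t * (Rabs x / sqrt t) / 4))).
Proof.
  intros Ht. pose proof PI_RGT_0 as HP. pose proof (sqrt_lt_R0 _ HP).
  pose proof (sqrt_lt_R0 _ Ht) as Hs.
  assert (Hst : sqrt t * sqrt t = t) by (apply sqrt_sqrt; lra).
  assert (HsP : sqrt PI * sqrt PI = PI) by (apply sqrt_sqrt; lra).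
  assert (Hxx : Rabs x * Rabs x = x * x) by (rewrite <- Rabs_mult; apply Rabs_pos_eq; nra).
  unfold heatG.
  replace (4 * PI * t) with ((2 * 2) * (PI * t)) by ring.
  rewrite sqrt_mult, sqrt_square, sqrt_mult by nra.
  replace (- (x * x) / (4 * t)) with (- (Rabs x / sqrt t * (Rabs x / sqrt t) / 4)).
  - rewrite <- (Rmult_assoc (/ (PI * sqrt t))). f_equal.
    replace (PI * sqrt t) with (sqrt PI * sqrt PI * sqrt t) by now rewrite HsP.
    field. lra.
  - rewrite <- Hxx. replace (4 * t) with (4 * (sqrt t * sqrt t)) by now rewrite Hst.
    field. lra.
Qed.

(** With nodes scaled by [a0 = sqrt (L / T)], time [t] corresponds to [a = a0 sqrt t], and
    [delta <= t <= T] is exactly the window [L / r <= a^2 <= L] of [unit_time_error]. *)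
Lemma heat_sum_of_exponentials (eps delta T : R) :
  0 < eps -> eps < 0.1 -> 0 < delta -> 1000 * delta <= T ->
  exists (n : nat) (w s : nat -> Cx),
    (1 <= n)%nat /\
    INR n <= 1768 * ln (T / delta) * (ln (1 / eps) + ln (ln (T / delta))) /\
    (forall j, (j <= 2 * n)%nat -> ~ on_cut (s j)) /\
    (forall x t, delta <= t -> t <= T ->
       Cxmod (Cxadd (RtoCx (heatG x t)) (Cxopp (GA n w s x t))) < eps / sqrt t).
Proof.
  intros He0 He1 Hd HT. set (r := T / delta).
  assert (Hr : 1000 <= r).
  { unfold r. apply Rmult_le_reg_r with delta; [easy|].
    unfold Rdiv. rewrite Rmult_assoc, Rinv_l by lra. lra. }
  pose proof exp_le_3 as He3. pose proof (exp_pos 1) as Hep.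
  (* Because [exp 1 <= 3], logarithms are bounded below by comparison with powers of 3, such as
     [3^6 = 729 <= 1000]. *)
  assert (Hln : forall (k : nat) y, 3 ^ k <= y -> INR k <= ln y).
  { intros k y Hy. assert (0 < 3 ^ k) by (apply pow_lt; lra).
    rewrite <- (ln_exp (INR k)). apply ln_le; [apply exp_pos|].
    apply Rle_trans with (2 := Hy). rewrite <- (Rmult_1_r (INR k)), <- exp_pow_INR.
    apply pow_incr. lra. }
  assert (Hlr : 6 <= ln r) by (replace 6 with (INR 6) by (simpl; ring); apply Hln; lra).
  assert (Hle : 2 <= ln (1 / eps)).
  { replace 2 with (INR 2) by (simpl; ring). apply Hln. apply Rmult_le_reg_r with eps; [easy|].
    replace (1 / eps * eps) with 1 by (field; lra). lra. }
  assert (Hll : 1 <= ln (ln r)) by (apply (Hln 1%nat); lra).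
  set (L := ln (1 / eps) + ln (ln r)).
  assert (HL : 3 <= L) by (unfold L; lra).
  assert (HeL : exp (- L) = eps / ln r).
  { unfold L. rewrite exp_Ropp, exp_plus, !exp_ln by (try apply Rdiv_lt_0_compat; lra).
    field. lra. }
  destruct (exists_INR_between (51 * ln r)) as [J HJ]; [lra|].
  destruct (exists_INR_between (16 * L)) as [N HN]; [lra|].
  assert (HJ0 : (0 < J)%nat) by (apply INR_lt; simpl; lra).
  assert (HN0 : (0 < N)%nat) by (apply INR_lt; simpl; lra).
  destruct (ray_rule J N HN0) as [rule [Hlen [Hpos Hrule]]].
  assert (HT0 : 0 < T) by nra.
  set (a0 := sqrt (L / T)).
  assert (HLT : 0 < L / T) by (apply Rdiv_lt_0_compat; lra).
  assert (Ha0 : 0 < a0) by now apply sqrt_lt_R0.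
  assert (Ha02 : a0 * a0 = L / T) by (apply sqrt_sqrt; lra).
  pose proof PI_RGT_0 as HP.
  (* [c] is [- i a0 / (2 PI)], so that [c Q] plus its conjugate is [a0 / PI * Im Q]. *)
  set (c := (0, - (a0 / (2 * PI))) : C).
  set (r1 := map (fun p => (c * fst p, a0 * snd p))%C rule).
  set (r2 := map (fun p => (Cconj (fst p), Cconj (snd p))) r1).
  assert (Hr1 : forall p, In p r1 -> 0 < Re (snd p)).
  { intros p Hp. apply in_map_iff in Hp. destruct Hp as [q [<- Hq]]. cbn [snd].
    rewrite Cmult_comm, Re_scal_r. apply Rmult_lt_0_compat; auto. }
  destruct (GA_of_rule (r1 ++ r2) (2 * N * J)) as [w [s [Hcut HGA]]].
  { unfold r2, r1. rewrite length_app, !length_map, Hlen. lia. }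
  { intros p Hp. apply in_app_or in Hp. destruct Hp as [Hp|Hp]; [auto|].
    apply in_map_iff in Hp. destruct Hp as [q [<- Hq]]. apply (Hr1 q Hq). }
  exists (2 * N * J)%nat, w, s. split; [nia|]. split; [|split; [exact Hcut|]].
  (* Rounding up gives [N <= 17 L] and [J <= 52 ln r], and [2 * 17 * 52 = 1768]. *)
  { rewrite !mult_INR. change (INR 2) with 2.
    apply Rle_trans with (2 * (17 * L) * (52 * ln r)); [|right; ring].
    pose proof (pos_INR N). apply Rmult_le_compat; lra. }
  intros x t Ht1 Ht2. assert (Ht : 0 < t) by lra.
  pose proof (sqrt_lt_R0 _ Ht) as Hst.
  assert (Hsq : sqrt t * sqrt t = t) by (apply sqrt_sqrt; lra).
  set (a := a0 * sqrt t). set (X := Rabs x / sqrt t).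
  assert (Ha : 0 < a) by now apply Rmult_lt_0_compat.
  assert (HX : 0 <= X) by (apply Rdiv_le_0_compat; [apply Rabs_pos|easy]).
  assert (Haa : a * a = L * (t / T)).
  { unfold a. replace (a0 * sqrt t * (a0 * sqrt t)) with (a0 * a0 * (sqrt t * sqrt t)) by ring.
    rewrite Ha02, Hsq. field. lra. }
  assert (HtT : / r <= t / T <= 1).
  { unfold r. replace (/ (T / delta)) with (delta / T) by (field; lra).
    pose proof (Rinv_0_lt_compat T HT0). unfold Rdiv. split; [nra|].
    rewrite <- (Rinv_r T) by lra. nra. }
  assert (Ha2 : L / r <= a * a <= L) by (rewrite Haa; unfold Rdiv at 1; nra).
  pose proof (unit_time_error J N rule L r a X Hr HL ltac:(lra) ltac:(lra) Hrule Ha Ha2 HX) as Herr.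
  set (Q := lsum rule (heat_exp a X)) in *.
  assert (HG : GA (2 * N * J) w s x t = RtoCx (a0 / PI * Im Q)).
  { rewrite HGA. set (F := fun z : C => cexp (z * z * t - z * Rabs x)).
    rewrite lsum_app. unfold r2. rewrite lsum_conj by apply cexp_heat_conj.
    unfold r1. rewrite (lsum_map c (fun z => a0 * z)%C).
    replace (lsum rule (fun u => F (a0 * u)%C)) with Q.
    - destruct Q as [q1 q2]. unfold toCx, RtoCx, Cconj, Cplus, Cmult, Im; simpl.
      f_equal; [field; lra|ring].
    (* The exponents agree because [a^2 = a0^2 t] and [a X = a0 |x|]; the nodes [a0 z] do not depend
       on [t]. *)
    - unfold Q. apply lsum_ext. intros p _. unfold heat_exp, F, a, X. f_equal.
      replace (RtoC t) with (sqrt t * sqrt t)%C by now rewrite <- RtoC_mult, Hsq.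
      unfold Rdiv. rewrite !RtoC_mult, RtoC_inv by lra.
      field. intros H. apply RtoC_inj in H. lra. }
  rewrite HG, heatG_scaled by easy. fold X.
  set (E := sqrt PI / 2 * exp (- (X * X / 4))) in *.
  assert (Hmod : forall u v, Cxmod (Cxadd (RtoCx u) (Cxopp (RtoCx v))) = Rabs (u - v)).
  { intros u v. unfold Cxmod, Cxadd, Cxopp, RtoCx; simpl.
    rewrite <- sqrt_Rsqr_abs. f_equal. unfold Rsqr. ring. }
  rewrite Hmod.
  assert (HIm : Im (a * Q) = a * Im Q) by (rewrite Cmult_comm, Im_scal_r; ring).
  rewrite HIm in Herr.
  replace (/ (PI * sqrt t) * E - a0 / PI * Im Q)
    with ((E - a * Im Q) * / (PI * sqrt t)).
  2:{ unfold a. field. lra. }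
  rewrite Rabs_mult, Rabs_inv, (Rabs_pos_eq (PI * sqrt t)) by nra.
  apply Rmult_lt_reg_r with (PI * sqrt t); [nra|].
  rewrite Rmult_assoc, Rinv_l, Rmult_1_r by nra.
  replace (eps / sqrt t * (PI * sqrt t)) with (eps * PI) by (field; lra).
  apply Rle_lt_trans with (1 := Herr).
  assert (HPI : 2 < PI) by (pose proof PI2_1; lra).
  (* As [q ln r = eps], the error is at most [4 q^2 + 9 q eps], and [q <= eps / 6] puts it below
     [2 eps < PI eps]. *)
  set (q := exp (- L)) in *. assert (Hq : 0 < q) by apply exp_pos.
  assert (Hql : q * ln r = eps) by (rewrite HeL; field; lra).
  assert (Hq1 : q <= / 60) by nra.
  assert (H2L : exp (- (2 * L)) = q * q) by (unfold q; rewrite <- exp_plus; f_equal; ring).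
  assert (H10L : exp (- (10 * L)) <= exp (- (2 * L))) by (apply exp_le; lra).
  rewrite H2L in *.
  replace (9 * ln r * (q * q)) with (9 * q * eps) by (rewrite <- Hql; ring). nra.
Qed.

Theorem theorem1 :
  (forall (s x : R), 0 < s ->
     improper_int_0_inf (fun t => exp (- s * t) * heatG x t)
       (/ (2 * sqrt s) * exp (- sqrt s * Rabs x)))
  /\
  (exists C : R, 0 < C /\
     forall eps delta T : R,
       0 < eps -> eps < 0.1 -> 0 < delta -> 1000 * delta <= T ->
       exists (n : nat) (w s : nat -> Cx),
         (1 <= n)%nat /\
         INR n <= C * ln (T / delta) * (ln (1 / eps) + ln (ln (T / delta))) /\
         (forall j, (j <= 2 * n)%nat -> ~ on_cut (s j)) /\
         (forall x t, delta <= t -> t <= T ->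
            Cxmod (Cxadd (RtoCx (heatG x t)) (Cxopp (GA n w s x t))) < eps / sqrt t)).
Proof.
  split.
  - exact laplace_heat.
  - exists 1768. split; [lra|]. exact heat_sum_of_exponentials.
Qed.
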